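(* The factorial Grothendieck polynomials $G_\lambda(x|a)$, as $\lambda$ runs over all partitions with $\ell(\lambda)\le n$, form a basis of $\Lambda_n\otimes_{\mathbb{Z}}\mathbb{F}(\beta,a)$ over $\mathbb{F}(\beta,a)$.
   Context: Fix a positive integer $n$, a field $\mathbb{F}$, an indeterminate $\beta$ over $\mathbb{F}$, variables $x=(x_1,\dots,x_n)$ and a sequence of variables $a=(a_k)_{k\ge1}$; $\mathbb{F}(\beta,a)$ is the field of rational functions in $\beta$ and the $a_k$. $\Lambda_n$ is the ring of symmetric polynomials in $x_1,\dots,x_n$ over $\mathbb{Z}$. A partition is identified with its Young diagram (box $(i,j)$ in row $i$ from the top, column $j$); $\ell(\lambda)$ is its number of nonzero parts, $|\lambda|$ its number of boxes, $c(i,j)=j-i$ the content of a box. A set-valued $\lambda$-tableau $T$ assigns to each box $\alpha$ a non-empty set $T(\alpha)\subset\{1,\dots,n\}$ such that $\max T(\alpha)\le\min T(\alpha')$ if $\alpha$ is immediately left of $\alpha'$, and $\max T(\alpha)<\min T(\alpha')$ if $\alpha$ is immediately above $\alpha'$; $|T|=\sum_\alpha|T(\alpha)|$. With $x\oplus y=x+y+\beta xy$, $$G_\lambda(x|a)=\sum_T\beta^{|T|-|\lambda|}\prod_{\alpha\in\lambda,\ r\in T(\alpha)}\bigl(x_r\oplus a_{r+c(\alpha)}\bigr),$$ summed over all set-valued $\lambda$-tableaux (for the empty partition this is $1$). *)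

(* Defs.v *)
From HB Require Import structures.
From mathcomp Require Import all_boot all_order all_algebra.
From mathcomp Require Import finmap.
From mathcomp Require monalg.
From mathcomp Require Import mpoly.

Set Implicit Arguments.
Unset Strict Implicit.
Unset Printing Implicit Defensive.

Import GRing.Theory.
Local Open Scope ring_scope.

(* monalg and mpoly define clashing notations. *)
Module CPoly.
Import monalg.

(* F[X_0, X_1, X_2, ...], polynomials in countably many variables.  The
   library gives this ring only as a commutative ring; integrality is proved
   by Kronecker substitution X_i |-> X ^ (d ^ i), which is injective on
   polynomials whose exponents are all smaller than d. *)
Definition cpoly (F : fieldType) : Type := {malg F[{cmonom nat}]}.

HB.instance Definition _ (F : fieldType) :=
  GRing.ComNzRing.copy (cpoly F) {malg F[{cmonom nat}]}.

Section CountablePolynomials.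
Variable F : fieldType.
Implicit Types (p q : cpoly F) (m : {cmonom nat}) (d : nat).

Lemma digits_inj d N (f g : nat -> nat) :
  (forall i, f i < d)%N -> (forall i, g i < d)%N ->
  (\sum_(i < N) f i * d ^ i = \sum_(i < N) g i * d ^ i)%N ->
  forall i, (i < N)%N -> f i = g i.
Proof.
elim: N f g => [//|N IHN] f g ltf ltg.
rewrite !big_ord_recl /= !muln1 => eq_sum.
have shift h : (\sum_(i < N) h (bump 0 i) * d ^ bump 0 i
    = (\sum_(i < N) h i.+1 * d ^ i) * d)%N.
  by rewrite big_distrl; apply: eq_bigr => i _; rewrite /= expnSr mulnA.
move: eq_sum; rewrite !shift => eq_sum.
have d_gt0 : (0 < d)%N by apply: leq_ltn_trans (ltf 0).
have eq0 : f 0 = g 0.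
  have /(congr1 (modn^~ d)) := eq_sum.
  by rewrite /= ![(_ + _ * d)%N]addnC !modnMDl !modn_small.
case=> [//|i]; rewrite ltnS => ltiN.
apply: (IHN (fun i => f i.+1) (fun i => g i.+1)) => //.
move/eqP: eq_sum; rewrite eq0 eqn_add2l eqn_pmul2r //.
by move/eqP.
Qed.

Definition kron_wt d m : nat := (\sum_(i <- finsupp m) m i * d ^ i)%N.

Lemma kron_wtE d m (E : {fset nat}) : (finsupp m `<=` E)%fset ->
  kron_wt d m = (\sum_(i <- E) m i * d ^ i)%N.
Proof.
move=> sub; rewrite /kron_wt (big_fset_incl _ sub) //= => i _.
by rewrite -cmE_eq0 => /eqP ->.
Qed.

Lemma kron_wt1 d : kron_wt d mone = 0%N.
Proof. by rewrite /kron_wt mdom1 big_seq_fset0. Qed.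

Lemma kron_wtM d m1 m2 : kron_wt d (mmul m1 m2) = (kron_wt d m1 + kron_wt d m2)%N.
Proof.
rewrite {1}/kron_wt mdomD (kron_wtE d (fsubsetUl _ (finsupp m2))).
rewrite (kron_wtE d (fsubsetUr (finsupp m1) _)) -big_split /=.
by apply: eq_bigr => i _; rewrite cmM mulnDl.
Qed.

Lemma kron_wt_inj d m1 m2 :
  (forall i, m1 i < d)%N -> (forall i, m2 i < d)%N ->
  kron_wt d m1 = kron_wt d m2 -> m1 = m2.
Proof.
move=> lt1 lt2 eq12; pose E := (finsupp m1 `|` finsupp m2)%fset.
pose N := (\max_(i <- E) i).+1.
have ltN i : i \in E -> (i < N)%N.
  by move=> iE; rewrite ltnS (big_fsetD1 i) //= leq_maxl.
have wtN m : (finsupp m `<=` E)%fset ->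
    kron_wt d m = (\sum_(i < N) m i * d ^ i)%N.
  move=> /fsubsetP sub; pose EN := seq_fset tt (iota 0 N).
  rewrite (@kron_wtE d m EN); last first.
    by apply/fsubsetP => i /sub /ltN; rewrite seq_fsetE mem_iota.
  rewrite -(big_mkord xpredT (fun i => m i * d ^ i)%N) /index_iota subn0.
  by apply: perm_big; rewrite -(undup_id (iota_uniq 0 N)) seq_fset_perm.
move: eq12; rewrite !wtN ?fsubsetUl ?fsubsetUr // => /(digits_inj lt1 lt2) eqN.
apply/eqP/cmP => i; have [/eqN //|leNi] := ltnP i N.
have: i \notin E by apply: contraL leNi => /ltN; rewrite -ltnNge.
by rewrite in_fsetU negb_or -!cmE_eq0 => /andP[/eqP -> /eqP ->].
Qed.

Definition kron_mon d m : {poly F} := 'X^(kron_wt d m).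

Lemma kron_mon_mmorphism d : mmorphism (kron_mon d).
Proof.
by split=> [m1 m2|]; rewrite /kron_mon ?kron_wtM ?exprD // kron_wt1 expr0.
Qed.

HB.instance Definition _ d :=
  isMultiplicative.Build _ _ (kron_mon d) (kron_mon_mmorphism d).

Definition kron d (p : {malg F[{cmonom nat}]}) : {poly F} :=
  mmap (@polyC F) (kron_mon d) p.

Lemma kronM d p q : kron d (p * q) = kron d p * kron d q.
Proof. exact: rmorphM. Qed.

Lemma kron1 d : kron d 1 = 1.
Proof. exact: rmorph1. Qed.

Definition exp_bounded d p :=
  forall m i, m \in msupp p -> (m i < d)%N.

Lemma coef_kron d p m : exp_bounded d p -> m \in msupp p ->
  (kron d p)`_(kron_wt d m) = mcoeff m p.
Proof.
move=> bp mp; rewrite /kron /mmap coef_sum (big_fsetD1 m) //=.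
rewrite coefCM coefXn eqxx mulr1 big_seq big1 ?addr0 // => k.
rewrite in_fsetD1 => /andP[neq_km kp].
rewrite coefCM coefXn; case: eqP => [eq_wt|]; last by rewrite mulr0.
case/negP: neq_km; apply/eqP; apply: (kron_wt_inj (d := d)) => // i; exact: bp.
Qed.

Lemma exp_boundedE p : exists d0, forall d, (d0 <= d)%N -> exp_bounded d p.
Proof.
exists (\max_(m <- msupp p) (mdeg m).+1)%N => d le_d m i mp.
apply: leq_trans le_d; rewrite (big_fsetD1 m) //= leq_max ltnS.
apply/orP; left; rewrite /mdeg; case: (mdomP m i) => // im.
by rewrite (big_fsetD1 i) //= leq_addr.
Qed.

Lemma kron_neq0 d p : exp_bounded d p -> p != 0 -> kron d p != 0.
Proof.
move=> bp; rewrite -msupp_eq0 => /fset0Pn[m mp].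
apply/eqP => /(congr1 (fun r : {poly F} => r`_(kron_wt d m))) /eqP.
by rewrite coef_kron // coef0 mcoeff_eq0 mp.
Qed.

Lemma cpoly_integral p q : p * q = 0 -> (p == 0) || (q == 0).
Proof.
move=> pq0; apply: contraT; rewrite negb_or => /andP[p0 q0].
have [[d1 b1] [d2 b2]] := (exp_boundedE p, exp_boundedE q).
have /negP[] : kron (maxn d1 d2) p * kron (maxn d1 d2) q != 0.
  by rewrite mulf_neq0 // kron_neq0 //; [apply/b1/leq_maxl|apply/b2/leq_maxr].
by rewrite -kronM pq0 /kron raddf0.
Qed.

Definition cpoly_unit : pred (cpoly F) :=
  fun p => (p == malgC (mcoeff mone p))
    && (mcoeff mone p != 0).

Definition cpoly_inv p : cpoly F :=
  if p \in cpoly_unit then malgC (mcoeff mone p)^-1 else p.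

Lemma cpoly_mulVp : {in cpoly_unit, left_inverse 1 cpoly_inv *%R}.
Proof.
move=> p Up; rewrite /cpoly_inv Up; case/andP: Up => /eqP {3}-> u.
by rewrite -[LHS](rmorphM (@mkmalgU {cmonom nat} F mone)) mulVf.
Qed.

Lemma cpoly_intro_unit p q : q * p = 1 -> p \in cpoly_unit.
Proof.
move=> qp1; have [d0 b0] := exp_boundedE p.
pose d := d0.+1; have bp : exp_bounded d p by apply: b0; rewrite leqnSn.
have sz_kp : size (kron d p) = 1%N.
  have : kron d q * kron d p = 1 by rewrite -kronM qp1 kron1.
  move=> qp; have : kron d p \is a GRing.unit.
    by apply/unitrP; exists (kron d q); split=> //; rewrite mulrC.
  by rewrite poly_unitE => /andP[/eqP].
have supp1 m : m \in msupp p -> m = mone.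
  move=> mp; apply: (kron_wt_inj (d := d)) => [i|i|]; first exact: bp.
    by rewrite cm1.
  rewrite kron_wt1; apply/eqP; apply: contraT; rewrite -lt0n => wt_gt0.
  have := coef_kron bp mp; rewrite nth_default ?sz_kp // => /esym/eqP.
  by rewrite mcoeff_eq0 mp.
have defp : p = malgC (mcoeff mone p).
  apply/malgP => m; rewrite mcoeffC.
  have [->|neq1] := eqVneq m mone; first by rewrite mulr1n.
  rewrite mulr0n; apply/eqP; rewrite mcoeff_eq0.
  by apply: contra neq1 => /supp1 ->.
apply/andP; split; first exact/eqP.
apply/eqP => p10; move: qp1; rewrite defp p10 raddf0 mulr0 => /esym/eqP.
by rewrite oner_eq0.
Qed.

Lemma cpoly_inv_out : {in [predC cpoly_unit], cpoly_inv =1 id}.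
Proof. by rewrite /cpoly_inv => p /negbTE /= ->. Qed.

End CountablePolynomials.

HB.instance Definition _ (F : fieldType) :=
  GRing.ComNzRing_hasMulInverse.Build (cpoly F)
    (@cpoly_mulVp F) (@cpoly_intro_unit F) (@cpoly_inv_out F).
HB.instance Definition _ (F : fieldType) :=
  GRing.ComUnitRing_isIntegral.Build (cpoly F) (@cpoly_integral F).

Definition cvar (F : fieldType) (k : nat) : cpoly F := mkmalgU (ucm k) 1.

End CPoly.
Export CPoly.

(* F(beta, a_1, a_2, ...): the variable X_0 is beta, and X_k is a_k for
   k >= 1.  The symbol [avar] is only meaningful for positive indices. *)
Definition ratfun (F : fieldType) : fieldType := {fraction (cpoly F)}.

Definition beta (F : fieldType) : ratfun F := FracField.tofrac (cvar F 0).
Definition avar (F : fieldType) (k : nat) : ratfun F := FracField.tofrac (cvar F k).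

Definition is_partition (la : seq nat) : bool := sorted geq la && (0%N \notin la).

Definition partition_upto (n : nat) : Type :=
  {la : seq nat | is_partition la && (size la <= n)%N}.

(* Rows and columns are numbered from 1, as are the entries of a tableau:
   r : 'I_n stands for the entry r.+1. *)
Definition box (la : seq nat) : finType :=
  {i : 'I_(size la) & 'I_(nth 0%N la i)}.

Section Tableaux.
Variables (n : nat) (la : seq nat).
Implicit Types (b : box la) (A : {set 'I_n}) (T : {ffun box la -> {set 'I_n}}).

Definition box_row b : nat := (tag b).+1.
Definition box_col b : nat := (tagged b).+1.

Definition entry (r : 'I_n) : nat := r.+1.

(* The default values 0 and n are irrelevant for non-empty A. *)
Definition max_entry A : nat := \max_(r in A) entry r.
Definition min_entry A : nat := \big[minn/n]_(r in A) entry r.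

Definition immediately_left b b' : bool :=
  (box_row b == box_row b') && ((box_col b).+1 == box_col b').
Definition immediately_above b b' : bool :=
  ((box_row b).+1 == box_row b') && (box_col b == box_col b').

Definition set_valued_tableau T : bool :=
  [&& [forall b, T b != set0],
      [forall b, forall b', immediately_left b b' ==>
         (max_entry (T b) <= min_entry (T b'))%N]
    & [forall b, forall b', immediately_above b b' ==>
         (max_entry (T b) < min_entry (T b'))%N]].

Definition tableau_size T : nat := (\sum_b #|T b|)%N.

End Tableaux.

Definition oplus (F : fieldType) (n : nat) (x y : {mpoly (ratfun F)[n]}) :
    {mpoly (ratfun F)[n]} :=
  x + y + beta F *: (x * y).

(* Column strictness gives entry r >= box_row b, so the truncated subtraction
   computing the index r + c(b) is exact and the index is at least 1; likewise
   |T| >= |la| because the entries are non-empty sets. *)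
Definition Groth (F : fieldType) (n : nat) (la : seq nat) :
    {mpoly (ratfun F)[n]} :=
  \sum_(T : {ffun box la -> {set 'I_n}} | set_valued_tableau T)
    beta F ^+ (tableau_size T - sumn la) *:
      \prod_(b : box la) \prod_(r in T b)
        oplus 'X_r (avar F (entry r + box_col b - box_row b))%:MP.

Section Bases.
Variables (K : fieldType) (V : lmodType K) (I : eqType) (v : I -> V).

Definition in_span (x : V) : Prop :=
  exists (s : seq I) (c : I -> K), x = \sum_(i <- s) c i *: v i.

Definition lin_indep : Prop :=
  forall (s : seq I) (c : I -> K), uniq s ->
    \sum_(i <- s) c i *: v i = 0 -> forall i, i \in s -> c i = 0.

Definition is_basis_of (S : V -> Prop) : Prop :=
  [/\ forall i, S (v i), forall x, S x -> in_span x & lin_indep].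

End Bases.

Definition sym_int (n : nat) : Type :=
  {f : {mpoly int[n]} | f \is symmetric}.

(* The ring Lambda_n (x)_Z K, realised inside K[x_1, ..., x_n] as the set of
   finite sums of c * f with c in K and f in Lambda_n.  The canonical map
   from the tensor product to K[x_1, ..., x_n] is injective because
   Z[x_1, ..., x_n] / Lambda_n is torsion-free. *)
Definition Lambda (K : fieldType) (n : nat) (p : {mpoly K[n]}) : Prop :=
  in_span (fun f : sym_int n => map_mpoly intr (val f)) p.

(* Main.v *)
Require Import Defs.
From mathcomp Require Import all_boot all_order all_algebra all_fingroup.
From mathcomp Require monalg.
From mathcomp Require Import mpoly.
From mathcomp Require Import zify ring.

(** Put [u_r = 1 + beta x_r] and [B_k = 1 + beta a_k], so that
    [beta (x_r (+) a_k) = u_r B_k - 1] and [1 + beta (x_r (+) a_k) = u_r B_k].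
    Removing the entries [n], then [n - 1], etc. from a set-valued tableau
    writes [beta ^ |la| G_la] as a sum over chains of interlacing partitions,
    i.e. as an iterated transfer operator.

    Symmetry: two consecutive transfer steps, seen as a sum over the middle
    partition, factor over the rows; each factor is symmetric up to boundary
    terms that pair up between adjacent rows, by telescoping
    [(u' B_t - 1) - (u B_t - 1) = (u' - u) B_t].

    Independence: at the point [u_r = 1 / B_{mu_{n+1-r} + r}] the polynomial
    [G_la] vanishes unless [la] is contained in [mu], and [G_mu] does not vanish.

    Generation: [G_la] has degree at most [la_1] in each variable.  The
    partitions contained in an [n x d] rectangle are as many as the monomial
    symmetric functions of degree at most [d] in each variable, so the
    independent family of the corresponding [G_la] spans the symmetric
    polynomials of degree at most [d] in each variable. *)

Set Implicit Arguments.
Unset Strict Implicit.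
Unset Printing Implicit Defensive.
Import GRing.Theory.
Local Open Scope ring_scope.

(** * Commutation of transfer steps *)

Section Core.
Variables (A : idomainType) (b : nat -> A).

(** Weights of a row with middle length [t]: the columns before [t] carry [y], the others [x]. The
    entry paired with [x] is one larger, hence [j.+1]. *)
Definition mixed (x y : A) lo hi t : A :=
  (\prod_(t <= j < hi) (x * b j.+1 - 1)) * (\prod_(lo <= j < t) (y * b j - 1)).

Definition full (x : A) lo hi : A := \prod_(lo <= j < hi.+1) (x * b j - 1).

Lemma fullS x lo hi : (lo <= hi.+1)%N -> full x lo hi.+1 = full x lo hi * (x * b hi.+1 - 1).
Proof. by move=> le; rewrite /full big_nat_recr. Qed.

Definition mixed_sum x y lo hi := \sum_(lo <= t < hi.+1) mixed x y lo hi t * b t.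

(** Telescoping: [(y - x) * b t] is [(y * b t - 1) - (x * b t - 1)], and these two factors complete
    [mixed] to products over all columns from [lo] to [hi] that switch from [y] to [x] after,
    respectively before, column [t]. *)
Lemma mixed_sumE x y lo hi : (lo <= hi)%N ->
  (y - x) * mixed_sum x y lo hi = full y lo hi - full x lo hi.
Proof.
rewrite /mixed_sum; elim: hi => [|hi IHhi].
  rewrite leqn0 => /eqP->; rewrite /mixed /full !big_nat1 !big_geq //; ring.
rewrite leq_eqVlt => /predU1P[->|lohi].
  by rewrite /mixed /full !big_nat1 !big_geq //; ring.
rewrite ltnS in lohi; rewrite big_nat_recr ?(leqW lohi) //=.
rewrite !fullS ?(leqW lohi) //.
rewrite {2}/mixed [X in X * _ * b hi.+1]big_geq // mul1r.
have -> : \sum_(lo <= t < hi.+1) mixed x y lo hi.+1 t * b t =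
   (\sum_(lo <= t < hi.+1) mixed x y lo hi t * b t) * (x * b hi.+1 - 1).
  rewrite big_distrl /=; apply: eq_big_nat => t /andP[_ lt_t].
  by rewrite /mixed big_nat_recr //=; ring.
have := IHhi lohi; set s := \sum_(_ <= _ < _) _ => IH.
rewrite mulrDr mulrA IH; rewrite -/(full y lo hi); ring.
Qed.

(** For [x != y] cancel [y - x]: a quotient of two antisymmetric expressions is symmetric. *)
Lemma antisym_quotient (F G : A -> A -> A) x y :
  (forall x y, (y - x) * F x y = G x y) -> G y x = - G x y -> F x y = F y x.
Proof.
move=> FG anti; have [->//|ne] := eqVneq x y.
have nz : y - x != 0 by rewrite subr_eq0 eq_sym.
apply: (mulfI nz); rewrite FG; apply: oppr_inj.
by rewrite -anti -FG; ring.
Qed.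

(* The sum over the length [t] of one row of the middle partition.  The flag
   [e] (resp. [d]) means that the lower (resp. upper) bound on [t] is such that
   every term carries a corner factor; the part of it that does not depend on
   [t] is then taken out of the sum. *)
Definition core (e d : bool) x y lo hi :=
  \sum_(lo <= t < hi.+1) mixed x y lo hi t *
    (if e then b t else if (lo < t)%N then x * b t else 1) *
    (if d then 1 else if (t < hi)%N then y * b hi else 1).

Lemma mixed_lo x y lo hi : (lo <= hi)%N -> mixed x y lo hi lo * (x * b lo - 1) = full x lo hi.
Proof.
move=> lohi; rewrite /mixed [X in _ * X * _]big_geq // mulr1 mulrC.
by rewrite /full [RHS]big_nat_recl.
Qed.

Lemma mixed_hi x y lo hi : (lo <= hi)%N -> mixed x y lo hi hi * (y * b hi - 1) = full y lo hi.
Proof.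
by move=> lohi; rewrite /mixed big_geq // mul1r /full big_nat_recr.
Qed.

(** End terms that lack a corner factor are completed at the cost of a multiple of [full]. What
    results is a combination of [mixed_sum] and [full] that is antisymmetric after multiplication by
    [y - x], or symmetric because [mixed_sum] is. *)
Lemma core_sym e d x y lo hi : (lo <= hi)%N -> core e d x y lo hi = core e d y x lo hi.
Proof.
move=> lohi.
have lohi1 := leqW lohi.
have sym11 : core true true x y lo hi = core true true y x lo hi.
  apply: (@antisym_quotient (fun x y => core true true x y lo hi)
    (fun x y => full y lo hi - full x lo hi)) => [u v|]; last by ring.
  rewrite -mixed_sumE //; congr (_ * _); apply: eq_bigr => t _; ring.
have core01 u v : core false true u v lo hi = u * mixed_sum u v lo hi - full u lo hi.
  rewrite /core /mixed_sum -(mixed_lo u v lohi) !(@big_ltn _ _ _ lo hi.+1) //= ltnn.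
  rewrite big_nat_cond mulrDr mulr_sumr [X in _ = _ + X - _]big_nat_cond.
  rewrite [X in _ + X = _](eq_bigr (fun i => u * (mixed u v lo hi i * b i))).
    by ring.
  by move=> t /andP[/andP[-> _] _]; ring.
have core10 u v : core true false u v lo hi = b hi * (v * mixed_sum u v lo hi - full v lo hi).
  rewrite /core /mixed_sum -(mixed_hi u v lohi) !big_nat_recr //= ltnn.
  rewrite big_nat_cond [X in _ = _ * (_ * (X + _) - _)]big_nat_cond.
  rewrite [X in X + _ = _](eq_bigr (fun i => (v * b hi) * (mixed u v lo hi i * b i))).
    by rewrite -mulr_sumr; ring.
  by move=> t /andP[/andP[_ ->] _]; ring.
have core00 u v : (lo < hi)%N -> core false false u v lo hi =
   b hi * (u * v * mixed_sum u v lo hi - (u * full v lo hi + v * full u lo hi)).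
  move=> lthi; rewrite /core /mixed_sum -(mixed_lo u v lohi) -(mixed_hi u v lohi).
  rewrite !(@big_ltn _ _ _ lo hi.+1) // !big_nat_recr //= !ltnn lthi.
  rewrite big_nat_cond [X in _ = _ * (_ * (_ + (X + _)) - _)]big_nat_cond.
  rewrite [X in _ + (X + _) = _](eq_bigr (fun i => (u * v * b hi) * (mixed u v lo hi i * b i))).
    by rewrite -mulr_sumr; ring.
  by move=> t /andP[/andP[-> ->] _]; ring.
case: e d => [] [] //.
- rewrite !core10; congr (_ * _).
  apply: (@antisym_quotient (fun x y => y * mixed_sum x y lo hi - full y lo hi)
    (fun x y => x * full y lo hi - y * full x lo hi)) => [u v|]; last by ring.
  by rewrite mulrBr mulrCA mixed_sumE //; ring.
- rewrite !core01.
  apply: (@antisym_quotient (fun x y => x * mixed_sum x y lo hi - full x lo hi)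
    (fun x y => x * full y lo hi - y * full x lo hi)) => [u v|]; last by ring.
  by rewrite mulrBr mulrCA mixed_sumE //; ring.
- move: lohi; rewrite leq_eqVlt => /predU1P[<-|lthi].
    by rewrite /core !big_nat1 !ltnn /mixed !big_geq.
  rewrite !core00 //; congr (_ * _).
  have -> : mixed_sum x y lo hi = mixed_sum y x lo hi; last by ring.
  by move: sym11; rewrite /core /mixed_sum /=; under eq_bigr do rewrite mulr1;
    under [RHS]eq_bigr do rewrite mulr1.
Qed.

End Core.

(** * The sum over one row of the middle partition *)

Section RowSum.
Variables (A : idomainType) (b : nat -> A).

Definition below (o : option nat) t := if o is Some s then (t <= s)%N else true.

(* The contribution of row [i] to two steps from [nu] to [m] to [l], with
   [p = l i], [q = l i.+1], [s = nu i], [t = m i], and [o = Some (nu i.-1)],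
   or [None] if [i = 0]. *)
Definition row_term x y p q s o t : A :=
  (if (q <= t <= p)%N && (s <= t)%N && below o t then
    (\prod_(t <= j < p) (x * b j.+1 - 1)) * (if (q < t)%N then x * b t else 1) *
    (\prod_(s <= j < t) (y * b j - 1)) *
    (if o is Some s' then if (t < s')%N then y * b s' else 1 else 1)
  else 0).

(* The asymmetric part shared by rows [i] and [i.+1]: it occurs in row [i] with
   [x] and [y] exchanged with respect to row [i.+1]. *)
Definition edge (c : nat -> A) (z w : A) p s : A :=
  (\prod_(s <= j < p) (z * c j - 1)) * (if (p < s)%N then w else 1).

Definition top_edge x y p o : A :=
  if o is Some s' then edge (b \o succn) x y p s' else 1.

Definition row_core x y p q s o : A :=
  let hi := if o is Some s' then minn p s' else p in
  let lo := maxn q s in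
  if (lo <= hi)%N then
    (if o is Some s' then if (p < s')%N then b s' else 1 else 1) *
    core b (q < s)%N (if o is Some s' then (p < s')%N else true) x y lo hi
  else 0.

Lemma row_core_sym x y p q s o : row_core x y p q s o = row_core y x p q s o.
Proof. by rewrite /row_core; case: ifP => // le; rewrite core_sym. Qed.

(** The columns from [s] to [q] and from [s'] to [p] carry the same variable for every admissible
    [t], and the variable of a corner factor forced by [q < s] or [p < s'] is always present; these
    common factors form the edges. *)
Lemma row_sumE x y p q s o M : (p < M)%N ->
  \sum_(t < M) row_term x y p q s o t =
  top_edge x y p o * edge b y x q s * row_core x y p q s o.
Proof.
move=> ltpM; rewrite /row_core; set hi := if o is Some _ then _ else _.
have lehip : (hi <= p)%N by rewrite /hi; case: (o) => [s'|//]; exact: geq_minl.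
have condE t : ((q <= t <= p) && (s <= t) && below o t)%N =
    (maxn q s <= t <= hi)%N.
  rewrite /below /hi geq_max; case: (o) => [s'|]; rewrite ?leq_min; lia.
case: (boolP (maxn q s <= hi)%N) => [lohi|]; rewrite -?ltnNge; last first.
  move=> hilo; rewrite mulr0 big1 // => t _; rewrite /row_term condE; case: ifP => // /andP[h1 h2].
  by rewrite ltnNge (leq_trans h1 h2) in hilo.
have -> : \sum_(t < M) row_term x y p q s o t =
    \sum_(maxn q s <= t < hi.+1) row_term x y p q s o t.
  rewrite -(big_mkord xpredT (row_term x y p q s o)).
  rewrite (big_nat_widen (maxn q s) hi.+1 M); last by lia.
  rewrite (big_nat_widenl (maxn q s) 0) // [in RHS]big_mkcond.
  apply: eq_bigr => t _.
  by rewrite /= ltnS andbC /row_term condE; case: ifP.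
rewrite /core mulrA mulr_sumr; apply: eq_big_nat => t /andP[lot thi].
rewrite /row_term condE lot -ltnS thi.
rewrite /mixed (big_cat_nat (n := hi) thi lehip) /=.
rewrite [\prod_(s <= j < t) _](big_cat_nat (n := maxn q s) (leq_maxr q s) lot) /=.
have -> : \prod_(s <= j < maxn q s) (y * b j - 1) = \prod_(s <= j < q) (y * b j - 1).
  by rewrite /maxn; case: ltnP => // le; rewrite !big_geq // ltnW.
have -> : \prod_(hi <= j < p) (x * b j.+1 - 1) =
    if o is Some s' then \prod_(s' <= j < p) (x * b j.+1 - 1) else 1.
  rewrite /hi; case: (o) => [s'|]; last by rewrite big_geq.
  by rewrite /minn; case: ltnP => // le; rewrite !big_geq // ltnW.
rewrite /edge /top_edge.
have -> : (if (q < t)%N then x * b t else 1) = (if (q < s)%N then x else 1) *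
   (if (q < s)%N then b t else if (maxn q s < t)%N then x * b t else 1).
  case: (ltnP q s) => [ltqs|leqs].
    by rewrite ifT //; lia.
  by rewrite mul1r.
have -> : (if o is Some s' then if (t < s')%N then y * b s' else 1 else 1) =
  (if o is Some s' then if (p < s')%N then y else 1 else 1) *
  (if o is Some s' then if (p < s')%N then b s' else 1 else 1) *
  (if if o is Some s' then (p < s')%N else true then 1 else
   if (t < hi)%N then y * b hi else 1).
  rewrite /hi /= in thi *; case: (o) thi => [s'|_]; last by rewrite !mul1r.
  rewrite ltnS leq_min => /andP[letp lets].
  case: (ltnP p s') => [ltps|leps]; first by rewrite mulr1 (leq_ltn_trans letp ltps).
  by rewrite !mul1r.
case: (o) => [s'|]; rewrite /edge /=; ring.
Qed.

End RowSum.

(** * Iterated transfer along chains of interlacing partitions *)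

Section Transfer.
Variables (A : comNzRingType) (B : nat -> A) (N M : nat).

(* Rows, columns and entries are numbered from 0.  From [m] to [l], the boxes of
   [l] outside [m] receive the entry [r]; the last box of a row of [m] may also
   receive it if no box of [l] lies below it, which gives the factor [row_old]. *)
Definition row_new z r i p t : A :=
  if (t <= p)%N then \prod_(t <= j < p) (z * B (r.+1 + j - i)%N - 1) else 0.

Definition row_old z r i q t : A :=
  if (q <= t)%N then if (q < t)%N then z * B (r + t - i)%N else 1 else 0.

Definition parts (m : {ffun 'I_N.+1 -> 'I_M}) i : nat :=
  oapp (fun i' => m i' : nat) 0%N (insub i).

Definition transfer_step z r (l m : nat -> nat) : A :=
  \prod_(i < N.+1) (row_new z r i (l i) (m i) * row_old z r i (l i.+1) (m i)).

(** All functions [m] are summed over, since a step that does not interlace has weight 0. In its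
    uses [l] vanishes from row [N] on, so the last of the [N.+1] rows is empty. *)
Fixpoint transfer (u : nat -> A) k (l : nat -> nat) : A :=
  if k is k'.+1 then
    \sum_(m : {ffun 'I_N.+1 -> 'I_M}) transfer_step (u k') k' l (parts m) * transfer u k' (parts m)
  else \prod_(i < N.+1) (l i == 0%N)%:R.

Lemma partsE m (i : 'I_N.+1) : parts m i = m i.
Proof. by rewrite /parts valK. Qed.

Lemma parts_oob m i : (N < i)%N -> parts m i = 0%N.
Proof. by move=> ltNi; rewrite /parts insubF // ltnS leqNgt ltNi. Qed.

Lemma step_eq z r l l' m : l =1 l' -> transfer_step z r l m = transfer_step z r l' m.
Proof. by move=> eql; apply: eq_bigr => i _; rewrite !eql. Qed.

Lemma transfer_eq u k l l' : l =1 l' -> transfer u k l = transfer u k l'.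
Proof.
case: k => [|k] eql /=; first by apply: eq_bigr => i _; rewrite eql.
by apply: eq_bigr => m _; rewrite (step_eq _ _ _ eql).
Qed.

Lemma transfer_equ u u' k l : (forall r, (r < k)%N -> u r = u' r) ->
  transfer u k l = transfer u' k l.
Proof.
elim: k l => //= k IHk l equ; apply: eq_bigr => m _.
by rewrite equ // IHk // => r ltrk; apply/equ/ltnW.
Qed.

Lemma step_interlace z r l m : transfer_step z r l m != 0 ->
  forall i, (i <= N)%N -> (l i.+1 <= m i <= l i)%N.
Proof.
move=> nz i leiN; move: nz; rewrite /transfer_step (bigD1 (Ordinal (leiN : (i < N.+1)%N))) //=.
rewrite /row_new /row_old.
case: (_ <= l i)%N; last by rewrite !mul0r eqxx.
by case: (_ <= m i)%N => //; rewrite mulr0 mul0r eqxx.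
Qed.

End Transfer.

Lemma transfer_eqB (A : comNzRingType) (B B' : nat -> A) N M u k l : B =1 B' ->
  transfer B N M u k l = transfer B' N M u k l.
Proof.
move=> eqB; elim: k l => //= k IHk l; apply: eq_bigr => m _; rewrite IHk.
congr (_ * _); apply: eq_bigr => i _; rewrite /row_new /row_old eqB.
by congr (_ * _); case: ifP => // _; apply: eq_bigr => j _; rewrite eqB.
Qed.

(** * Symmetry of the iterated transfer *)

Section TransferSym.
Variables (A : idomainType) (B : nat -> A) (N M : nat).
Local Notation parts := (@parts N M).
Local Notation step := (@transfer_step A B N).
Local Notation transfer := (@transfer A B N M).

(** The corner factor of the inner step in row [i] depends on the middle length in row [i.+1]. Once
    it is moved there, the sum over [m] factors into row sums. The upper edge of row [i.+1] is the
    lower edge of row [i] with the variables exchanged, and the cores are symmetric. *)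
Lemma step2_sym x y r l nu :
  (forall i, (l i < M)%N) -> (forall i, (N <= i)%N -> l i = 0%N) ->
  \sum_(m : {ffun 'I_N.+1 -> 'I_M}) step x r.+1 l (parts m) * step y r (parts m) nu =
  \sum_(m : {ffun 'I_N.+1 -> 'I_M}) step y r.+1 l (parts m) * step x r (parts m) nu.
Proof.
(* A box of [nu] in row [N], where [l] is empty, leaves no room for [m]: both sides vanish. *)
move=> ltM l0; have [nuN|nuN] := posnP (nu N); last first.
  have z0 a b m : step a r.+1 l (parts m) * step b r (parts m) nu = 0.
    apply/eqP; rewrite mulf_eq0; apply: contraT; rewrite negb_or.
    case/andP => /step_interlace/(_ N (leqnn N)) h1 /step_interlace/(_ N (leqnn N)).
    by move: h1; rewrite !l0 //; lia.
  by rewrite !big1.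
pose up i := if i is i'.+1 then Some (nu i') else None.
(* Since [bb i.+1 j.+1 = bb i j], adjacent rows see the same constants along their common edge. *)
pose bb i j := B (r.+1 + j - i)%N.
have stepE z w (m : {ffun 'I_N.+1 -> 'I_M}) :
    step z r.+1 l (parts m) * step w r (parts m) nu =
    \prod_(i < N.+1) row_term (bb i) z w (l i) (l i.+1) (nu i) (up i) (m i).
  rewrite /transfer_step -big_split /=.
  transitivity ((\prod_(i < N.+1) (row_new B z r.+1 i (l i) (m i) *
     row_old B z r.+1 i (l i.+1) (m i) * row_new B w r i (m i) (nu i))) *
     \prod_(i < N.+1) row_old B w r i (parts m i.+1) (nu i)).
    by rewrite -big_split; apply: eq_bigr => i _; rewrite partsE !mulrA.
  have -> : \prod_(i < N.+1) row_old B w r i (parts m i.+1) (nu i) =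
     \prod_(i < N.+1) (if (i : nat) is i'.+1 then row_old B w r i' (m i) (nu i') else 1).
    rewrite big_ord_recr big_ord_recl /= parts_oob // nuN /row_old leqnn ltnn.
    rewrite mulr1 mul1r; apply: eq_bigr => i _.
    by rewrite -(partsE m (lift ord0 i)).
  rewrite -big_split /=; apply: eq_bigr => i _.
  rewrite /row_term /row_new /row_old /bb.
  have -> : \prod_(m i <= j < l i) (z * B (r.+2 + j - i)%N - 1) =
      \prod_(m i <= j < l i) (z * B (r.+1 + j.+1 - i)%N - 1).
    by apply: eq_bigr => j _; rewrite addnS.
  move: (m i : nat) => t; case: i => [[|i] lti] /=.
    rewrite andbT mulr1; case: (t <= _)%N; case: (l 1 <= t)%N; case: (nu _ <= t)%N;
      by rewrite ?(mul0r, mulr0, mulr1).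
  rewrite !subSS; case: (t <= l _)%N; case: (l i.+2 <= t)%N; case: (nu _ <= t)%N;
    by case: (t <= nu _)%N; rewrite ?(mul0r, mulr0).
have sumE z w : \sum_(m : {ffun 'I_N.+1 -> 'I_M})
     step z r.+1 l (parts m) * step w r (parts m) nu =
    (\prod_(i < N) edge (bb i) z w (l i.+1) (nu i)) *
    (\prod_(i < N) edge (bb i) w z (l i.+1) (nu i)) *
    \prod_(i < N.+1) row_core (bb i) z w (l i) (l i.+1) (nu i) (up i).
  under eq_bigr do rewrite stepE.
  rewrite -(bigA_distr_bigA (fun (i : 'I_N.+1) (t : 'I_M) =>
     row_term (bb i) z w (l i) (l i.+1) (nu i) (up i) t)).
  under eq_bigr do rewrite row_sumE //.
  rewrite big_split [X in X * _ = _]big_split /=; congr (_ * _ * _).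
    rewrite big_ord_recl /= mul1r; apply: eq_bigr => i _.
    rewrite /top_edge /= /edge; congr (_ * _); apply: eq_bigr => j _.
    by rewrite /bb /= addnS subSS.
  by rewrite big_ord_recr /= /edge l0 // nuN big_geq // ltnn !mulr1.
rewrite !sumE [X in X * _]mulrC; congr (_ * _).
by apply: eq_bigr => i _; rewrite row_core_sym.
Qed.

Definition swap_at r (u : nat -> A) i := if i == r then u r.+1 else if i == r.+1 then u r else u i.

(** Only two consecutive steps are affected; with the sum over the partition between them innermost,
    [step2_sym] applies. Outer steps are peeled off by induction. *)
Lemma transfer_swap u k r l : (r.+1 < k)%N ->
  (forall i, (l i < M)%N) -> (forall i, (N <= i)%N -> l i = 0%N) ->
  transfer (swap_at r u) k l = transfer u k l.
Proof.
elim: k l => // k IHk l; rewrite ltnS leq_eqVlt => /predU1P[<-|ltrk] ltM l0.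
  rewrite /= /swap_at eqxx !(gtn_eqF (ltnSn r)) eqxx.
  have E z w : \sum_(m : {ffun 'I_N.+1 -> 'I_M}) step z r.+1 l (parts m) *
      (\sum_(m' : {ffun 'I_N.+1 -> 'I_M}) step w r (parts m) (parts m') *
         transfer u r (parts m')) =
      \sum_(m' : {ffun 'I_N.+1 -> 'I_M}) (\sum_(m : {ffun 'I_N.+1 -> 'I_M})
         step z r.+1 l (parts m) * step w r (parts m) (parts m')) *
         transfer u r (parts m').
    under eq_bigr do rewrite mulr_sumr.
    rewrite exchange_big /=; apply: eq_bigr => m' _; rewrite mulr_suml.
    by apply: eq_bigr => m _; rewrite mulrA.
  rewrite -/(swap_at r u) [RHS]E.
  transitivity (\sum_(m : {ffun 'I_N.+1 -> 'I_M}) step (u r) r.+1 l (parts m) *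
      (\sum_(m' : {ffun 'I_N.+1 -> 'I_M}) step (u r.+1) r (parts m) (parts m') *
         transfer u r (parts m'))).
    apply: eq_bigr => m _; congr (_ * _); apply: eq_bigr => m' _; congr (_ * _).
    apply: transfer_equ => i lti; rewrite /swap_at !ltn_eqF //; lia.
  by rewrite E; apply: eq_bigr => m' _; rewrite step2_sym.
rewrite /= /swap_at !gtn_eqF //; last by lia.
rewrite -/(swap_at r u); apply: eq_bigr => m _.
have [->|nz] := eqVneq (step (u k) k l (parts m)) 0; first by rewrite !mul0r.
congr (_ * _); apply: IHk => // i.
  rewrite /parts; case: insubP => /= [j _ _|_]; first exact: ltn_ord.
  exact: leq_ltn_trans (leq0n _) (ltM 0%N).
rewrite leq_eqVlt => /predU1P[<-|]; last exact: parts_oob.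
by have /andP[_] := step_interlace nz (leqnn N); rewrite l0 // leqn0 => /eqP.
Qed.

End TransferSym.

(** * Vanishing *)

Lemma rmorph_transfer (A A' : comNzRingType) (f : {rmorphism A -> A'}) B N M u k l :
  f (transfer B N M u k l) = transfer (f \o B) N M (f \o u) k l.
Proof.
elim: k l => [|k IHk] l /=.
  by rewrite rmorph_prod; apply: eq_bigr => i _; rewrite rmorph_nat.
rewrite rmorph_sum; apply: eq_bigr => m _; rewrite rmorphM IHk; congr (_ * _).
rewrite rmorph_prod; apply: eq_bigr => i _; rewrite rmorphM; congr (_ * _).
  rewrite /row_new; case: ifP => _; last exact: rmorph0.
  by rewrite rmorph_prod; apply: eq_bigr => j _; rewrite rmorphB rmorphM rmorph1.
rewrite /row_old; case: ifP => _; last exact: rmorph0.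
by case: ifP => _; rewrite ?rmorphM ?rmorph1.
Qed.

Section Vanishing.
Variables (A : idomainType) (B : nat -> A) (N M : nat).
Local Notation parts := (@parts N M).
Local Notation step := (@transfer_step A B N).
Local Notation transfer := (@transfer A B N M).

(** The largest entry is paired with row 0 of [rho], so removing this entry removes row 0. *)
Definition at_node (rho : nat -> nat) k (u : nat -> A) :=
  forall r, (r < k)%N -> u r * B (rho (k - r.+1) + r.+1)%N = 1.

Lemma at_nodeS rho k u : at_node rho k.+1 u -> at_node (rho \o succn) k u.
Proof.
move=> node r ltrk; have := node r (ltnW ltrk).
by rewrite subSS -(subnSK ltrk).
Qed.

(** By induction a contributing [m] fits in [rho] without row 0, which bounds all rows of [l] but
    the first. Were [l 0 > rho 0], the new box of row 0 in column [rho 0] would have weight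
    [u k * B (rho 0 + k.+1) - 1 = 0]. *)
Lemma transfer_vanish rho k u l :
  (forall i j, (i <= j)%N -> (rho j <= rho i)%N) ->
  (forall i, (k <= i)%N -> rho i = 0%N) -> at_node rho k u ->
  transfer u k l != 0 -> forall i, (i <= N)%N -> (l i <= rho i)%N.
Proof.
elim: k rho l => [|k IHk] rho l decr rho0 node /=.
  move=> nz i leiN; move: nz; rewrite (bigD1 (Ordinal (leiN : (i < N.+1)%N))) //=.
  by case: (l i =P 0%N) => [->|_] //; rewrite mul0r eqxx.
move=> nz i leiN.
have [m] : exists m : {ffun 'I_N.+1 -> 'I_M},
    step (u k) k l (parts m) * transfer u k (parts m) != 0.
  apply/existsP; apply: contraNT nz; rewrite negb_exists => /forallP z.
  by rewrite big1 // => m _; apply/eqP; rewrite -[_ == _]negbK.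
rewrite mulf_eq0 negb_or => /andP[nz_step nz_tr].
have lemrho j : (j <= N)%N -> (parts m j <= rho j.+1)%N.
  apply: (IHk (rho \o succn)) => //.
  - by move=> i' j' le; apply: decr.
  - by move=> i' le; apply: rho0.
  - exact: at_nodeS.
case: i leiN => [|i] leiN; last first.
  have /andP[le _] := step_interlace nz_step (ltnW leiN).
  by apply: leq_trans le (lemrho _ (ltnW leiN)).
rewrite leqNgt; apply: contra nz_step => ltrho.
rewrite /transfer_step (bigD1 ord0) //= /row_new.
have lem0 : (parts m 0 <= rho 0)%N by apply: leq_trans (lemrho _ leiN) (decr _ _ _).
case: ifP => _; last by rewrite !mul0r.
rewrite (big_cat_nat (n := rho 0%N)) ?(ltnW ltrho) //= (big_ltn ltrho) /=.
have := node k (ltnSn k); rewrite subnn addnC subn0 => ->.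
by rewrite subrr mul0r mulr0 !mul0r.
Qed.

(** A single chain contributes, the one that drops the first row at each step: vanishing bounds [m]
    from above, interlacing from below. Its weights are, up to [u k], differences of distinct values
    of [B]. *)
Lemma transfer_node rho k u :
  (forall i j, (i <= j)%N -> (rho j <= rho i)%N) ->
  (forall i, (k <= i)%N -> rho i = 0%N) -> at_node rho k u ->
  (forall i, (N <= i)%N -> rho i = 0%N) -> (rho 0 < M)%N ->
  injective B -> transfer u k rho != 0.
Proof.
move=> + + + + + injB; elim: k rho => [|k IHk] rho decr rho0 node rhoN ltM /=.
  by apply/prodf_neq0 => i _; rewrite rho0 // eqxx oner_neq0.
have ltM' i : (rho i < M)%N by apply: leq_ltn_trans ltM; apply: decr.
pose m0 : {ffun 'I_N.+1 -> 'I_M} := [ffun i : 'I_N.+1 => Ordinal (ltM' i.+1)].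
have m0E : parts m0 =1 rho \o succn.
  move=> i /=; have [leiN|ltNi] := leqP i N.
    by rewrite -[i]/(nat_of_ord (Ordinal (leiN : (i < N.+1)%N))) partsE ffunE.
  by rewrite parts_oob // rhoN // leqW // ltnW.
have decr' i j : (i <= j)%N -> (rho j.+1 <= rho i.+1)%N by move=> ?; apply: decr.
have rho0' i : (k <= i)%N -> rho i.+1 = 0%N by move=> ?; apply: rho0.
have node' := at_nodeS node.
rewrite (bigD1 m0) //= big1 ?addr0 => [|m nem].
  rewrite mulf_neq0 //; last first.
    rewrite (transfer_eq _ _ _ _ _ m0E); apply: IHk => // [i leNi|]; last exact: ltM'.
    by rewrite /= rhoN // leqW.
  apply/prodf_neq0 => i _; rewrite /row_new /row_old !m0E /= leqnn ltnn mulr1.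
  rewrite decr // prodf_seq_neq0; apply/allP => j.
  rewrite mem_index_iota => /andP[_ ltj]; rewrite /= subr_eq0 -(node k (ltnSn k)) subnn.
  have nzu : u k != 0.
    apply: contraTneq (oner_neq0 A) => u0.
    by rewrite -(node k (ltnSn k)) u0 mul0r eqxx.
  rewrite (inj_eq (mulfI nzu)) (inj_eq injB).
  (* The indices differ because [j < rho i <= rho 0]. *)
  by have := decr 0%N i (leq0n _); lia.
apply/eqP; apply: contraTT nem; rewrite mulf_eq0 negb_or negbK => /andP[nz1 nz2].
apply/eqP/ffunP => i; apply/val_inj; rewrite -[val _](partsE m) -[val _](partsE m0) m0E /=.
apply/eqP; rewrite eqn_leq.
have leiN : (i <= N)%N by rewrite -ltnS.
rewrite (transfer_vanish decr' rho0' node' nz2 leiN) /=.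
by case/andP: (step_interlace nz1 leiN).
Qed.

End Vanishing.

(** * Set-valued tableaux *)

Lemma count_down_closed (P : pred nat) c : (forall j, P j.+1 -> P j) ->
  forall j, (j < c)%N -> (j < count P (iota 0 c))%N = P j.
Proof.
move=> dc; have dcn j k : P (j + k)%N -> P j.
  by elim: k => [|k IHk]; rewrite ?addn0 // addnS => /dc /IHk.
elim: c => // c IHc j; rewrite -[in iota _ _]addn1 iotaD count_cat /= addn0 add0n.
rewrite ltnS => lejc; case: (boolP (P c)) => Pc; rewrite ?addn0.
  have all_P : all P (iota 0 c).
    apply/allP => i; rewrite mem_iota add0n => /andP[_ ltic].
    by apply: (dcn i (c - i)%N); rewrite subnKC // ltnW.
  move: all_P; rewrite all_count size_iota => /eqP ->; rewrite addn1 ltnS lejc.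
  by apply/esym/(dcn j (c - j)%N); rewrite subnKC.
move: lejc; rewrite leq_eqVlt => /predU1P[->|]; last exact: IHc.
rewrite (negbTE Pc) ltnNge; apply/negbF.
by apply: leq_trans (count_size _ _) _; rewrite size_iota.
Qed.

Section RowProduct.
Variable A : comNzRingType.

(** Column [j] of a row in [step_set], for [l i = p], [l i.+1 = q] and [m i = t]. *)
Definition row_factor (w : nat -> A) p q t j : A :=
  if (j < p)%N then (if (j.+1 < t)%N || (j < q)%N then 0 else w j) + (j < t)%N%:R
  else (~~ (j < t)%N)%:R.

(** New columns, from [t] to [p], give [w j]. Of the old ones only the last may receive the entry
    too, and only if nothing lies below, that is if [q < t]; the others give 1. If [p < t] or
    [t < q], column [p] or [t] gives 0. *)
Lemma row_factor_prod w c p q t : (q <= p <= c)%N -> (t <= c)%N ->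
  \prod_(0 <= j < c) row_factor w p q t j =
  (if (t <= p)%N then \prod_(t <= j < p) w j else 0) *
  (if (q <= t)%N then if (q < t)%N then w t.-1 + 1 else 1 else 0).
Proof.
case/andP=> leqp lepc letc; case: (leqP t p) => [letp|ltpt]; last first.
  have ltpc := leq_trans ltpt letc.
  rewrite mul0r (big_cat_nat (n := p)) //= [X in _ * X](big_ltn ltpc).
  by rewrite {2}/row_factor ltnn ltpt mul0r mulr0.
rewrite (big_cat_nat (n := p)) //= (big_cat_nat (n := t) _ letp) //=.
rewrite [X in _ * X]big_nat_cond [X in _ * X]big1 ?mulr1 => [|j]; last first.
  rewrite andbT /row_factor [(j < p)%N]ltnNge [(j < t)%N]ltnNge => /andP[lepj _].
  by rewrite lepj (leq_trans letp lepj).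
case: (leqP q t) => [leqt|ltqt]; last first.
  rewrite mulr0 [X in _ * X]big_ltn ?(leq_trans ltqt) //.
  by rewrite {2}/row_factor (leq_trans ltqt) // ltqt orbT ltnn addr0 mul0r mulr0.
rewrite mulrC; congr (_ * _).
  apply: eq_big_nat => j /andP[letj ltjp]; rewrite /row_factor ltjp.
  by rewrite !ltnNge letj (leq_trans leqt letj) (leqW letj) addr0.
case: t letp letc leqt => [|t] letp letc leqt; first by rewrite ltn0 big_geq.
rewrite big_nat_recr //= big_nat_cond big1 ?mul1r => [|j]; last first.
  rewrite andbT /row_factor => /andP[_ ltjt].
  have ltj : (j < t.+1)%N by apply: ltnW.
  by rewrite (leq_trans ltj letp) [(j.+1 < _)%N]ltnS ltjt ltj add0r.
rewrite /row_factor letp ltnn ltnSn /= [(q < _)%N]ltnS ltnNge.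
by case: leqP => _ //=; rewrite add0r.
Qed.

End RowProduct.

Section Tableaux.
Variables (A : comNzRingType) (B u : nat -> A) (n : nat) (la : seq nat).
Implicit Types (b : box la) (S D : {set box la}) (T : {ffun box la -> {set 'I_n}}).

Definition wt r b : A := u r * B (r.+1 + tagged b - tag b)%N - 1.

(** Tableaux of varying support share one type, with empty sets outside [S]; conditions on pairs of
    entries are void at empty boxes. *)
Definition tab k S T : bool :=
  [&& [forall b, (T b != set0) == (b \in S)],
      [forall b, forall r in T b, (r < k)%N],
      [forall b, forall b', immediately_left b b' ==>
        [forall r in T b, forall r' in T b', (r <= r')%N]]
    & [forall b, forall b', immediately_above b b' ==>
        [forall r in T b, forall r' in T b', (r < r')%N]]].

Definition tab_prop k S T :=
  [/\ forall b, (T b != set0) = (b \in S),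
      forall b (r : 'I_n), r \in T b -> (r < k)%N,
      forall b b', immediately_left b b' ->
        forall r r' : 'I_n, r \in T b -> r' \in T b' -> (r <= r')%N
    & forall b b', immediately_above b b' ->
        forall r r' : 'I_n, r \in T b -> r' \in T b' -> (r < r')%N].

Lemma tabP k S T : reflect (tab_prop k S T) (tab k S T).
Proof.
apply: (iffP and4P) => [[h1 h2 h3 h4]|[h1 h2 h3 h4]]; split.
- by move=> b; move/forallP: h1 => /(_ b)/eqP.
- by move=> b r; move/forallP: h2 => /(_ b) /forall_inP; apply.
- move=> b b' left_bb' r r' rT r'T; move: h3 => /forallP/(_ b)/forallP/(_ b').
  by move=> /implyP/(_ left_bb')/forall_inP/(_ r rT)/forall_inP; apply.
- move=> b b' above_bb' r r' rT r'T; move: h4 => /forallP/(_ b)/forallP/(_ b').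
  by move=> /implyP/(_ above_bb')/forall_inP/(_ r rT)/forall_inP; apply.
- by apply/forallP => b; apply/eqP.
- by apply/forallP => b; apply/forall_inP => r; apply: h2.
- apply/forallP => b; apply/forallP => b'; apply/implyP => left_bb'.
  by apply/forall_inP => r rT; apply/forall_inP => r'; exact: (h3 b b').
- apply/forallP => b; apply/forallP => b'; apply/implyP => above_bb'.
  by apply/forall_inP => r rT; apply/forall_inP => r'; exact: (h4 b b').
Qed.

Definition tab_wt T : A := \prod_b \prod_(r in T b) wt r b.

Definition tab_sum k S : A := \sum_(T | tab k S T) tab_wt T.

(** [D] holds the boxes receiving the new largest entry. A right neighbour in [S'] would contain a
    smaller entry, and a box of [S] below would need a larger one. *)
Definition addable S S' D : bool :=
  [&& D :|: S' == S,
      [forall b in D, forall b', immediately_left b b' ==> (b' \notin S')]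
    & [forall b in D, forall b', immediately_above b b' ==> (b' \notin S)]].

Lemma addableP S S' D : reflect
  [/\ D :|: S' = S,
      forall b b', b \in D -> immediately_left b b' -> b' \notin S'
    & forall b b', b \in D -> immediately_above b b' -> b' \notin S]
  (addable S S' D).
Proof.
apply: (iffP and3P) => [[/eqP h1 h2 h3]|[h1 h2 h3]]; split=> //.
- by move=> b b' bD; move: h2 => /forall_inP/(_ b bD)/forallP/(_ b')/implyP.
- by move=> b b' bD; move: h3 => /forall_inP/(_ b bD)/forallP/(_ b')/implyP.
- exact/eqP.
- by apply/forall_inP => b bD; apply/forallP => b'; apply/implyP; apply: h2.
- by apply/forall_inP => b bD; apply/forallP => b'; apply/implyP; apply: h3.
Qed.

Definition supp T := [set b | T b != set0].

Definition join (k : 'I_n) (p : {ffun box la -> {set 'I_n}} * {set box la}) :=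
  [ffun b => if b \in p.2 then k |: p.1 b else p.1 b].

Definition cut (k : 'I_n) T := ([ffun b => T b :\ k], [set b | k \in T b]).

Lemma cutK k T : join k (cut k T) = T.
Proof.
apply/ffunP => b; rewrite ffunE /= inE ffunE.
by case: ifP => kT; rewrite ?setD1K //; apply/setP=> r; rewrite !inE; case: eqP => // ->.
Qed.

Lemma joinE (k : 'I_n) T D b (r : 'I_n) :
  (r \in join k (T, D) b) = ((r == k) && (b \in D)) || (r \in T b).
Proof. by rewrite ffunE /=; case: ifP => bD; rewrite ?inE ?andbT ?andbF. Qed.

(** The equation on [cut] says that [k] is not in [T]; thus tableaux with entries up to [k]
    correspond to pairs of a smaller tableau and an addable set. *)
Lemma tab_join (k : 'I_n) S T D :
  tab k.+1 S (join k (T, D)) && (cut k (join k (T, D)) == (T, D)) =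
  tab k (supp T) T && addable S (supp T) D.
Proof.
have ne_join b : (join k (T, D) b != set0) = (b \in D :|: supp T).
  rewrite !inE; apply/set0Pn/orP => [[r]|[bD|/set0Pn[r rT]]].
  - rewrite joinE => /orP[/andP[_ ->]|rT]; first by left.
    by right; apply/set0Pn; exists r.
  - by exists k; rewrite joinE eqxx bD.
  - by exists r; rewrite joinE rT orbT.
apply/andP/andP => [[/tabP[h1 h2 h3 h4] /eqP cut_join]|[/tabP[h1 h2 h3 h4] /addableP[a1 a2 a3]]].
  have knT b : k \notin T b.
    by have [e _] := cut_join; rewrite -e ffunE !inE eqxx.
  have ltk b r : r \in T b -> (r < k)%N.
    move=> rT; have := h2 b r; rewrite joinE rT orbT ltnS leq_eqVlt => /(_ isT).
    by case/predU1P => // /val_inj eqk; have := knT b; rewrite -eqk rT.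
  split.
    apply/tabP; split=> [b|b r /ltk //|b b' l r r' rT r'T|b b' l r r' rT r'T].
    - by rewrite inE.
    - by apply: (h3 _ _ l); rewrite joinE ?rT ?r'T orbT.
    - by apply: (h4 _ _ l); rewrite joinE ?rT ?r'T orbT.
  apply/addableP; split=> [|b b' bD l|b b' bD l].
  - by apply/setP => b; rewrite -ne_join h1.
  - rewrite inE negbK; apply: contraT => /set0Pn[r' r'T].
    have := h3 _ _ l k r'; rewrite !joinE eqxx bD r'T orbT => /(_ isT isT).
    by rewrite leqNgt (ltk b').
  - rewrite -h1 negbK; apply: contraT => /set0Pn[r' r'T].
    have := h4 _ _ l k r' _ r'T; rewrite joinE eqxx bD => /(_ isT).
    by rewrite ltnNge -ltnS (h2 b').
have knT b : k \notin T b by apply/negP => /h2; rewrite ltnn.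
split; last first.
  rewrite /cut; apply/eqP; congr (_, _).
    apply/ffunP => b; rewrite ffunE; apply/setP => r; rewrite !inE joinE.
    by have [->|] := eqVneq r k; rewrite //= (negbTE (knT b)).
  by apply/setP => b; rewrite inE joinE eqxx (negbTE (knT b)) orbF.
apply/tabP; split=> [b|b r|b b' l r r'|b b' l r r'].
- by rewrite ne_join a1.
- by rewrite joinE ltnS => /orP[/andP[/eqP-> _]|/h2/ltnW].
- rewrite !joinE => /orP[/andP[/eqP-> bD]|rT] /orP[/andP[/eqP-> b'D]|r'T] //.
  + by have := a2 _ _ bD l; rewrite inE negbK => /eqP T0; rewrite T0 inE in r'T.
  + exact/ltnW/h2/rT.
  + exact: h3 l _ _ rT r'T.
- rewrite !joinE => /orP[/andP[/eqP-> bD]|rT] r'T.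
    have := a3 _ _ bD l; rewrite -a1 -ne_join negbK => /eqP T0.
    by have := joinE k T D b' r'; rewrite T0 inE r'T.
  case/orP: r'T => [/andP[/eqP-> _]|r'T]; first exact: h2 rT.
  exact: h4 l _ _ rT r'T.
Qed.

Lemma tab_wt_join (k : 'I_n) T D : (forall b, k \notin T b) ->
  tab_wt (join k (T, D)) = (\prod_(b in D) wt k b) * tab_wt T.
Proof.
move=> knT; rewrite /tab_wt [\prod_(b in D) _]big_mkcond -big_split /=.
apply: eq_bigr => b _; rewrite ffunE /=; case: ifP => bD; last by rewrite mul1r.
by rewrite big_setU1.
Qed.

(* The set of boxes receiving [k] consists of the boxes of [S] outside [S'] and
   of an arbitrary set of boxes of [S'] with no box of [S'] on the right and no
   box of [S] below; hence a product over the boxes. *)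
Definition step_set k S S' : A :=
  \prod_b (if b \in S then
     (if [exists b', immediately_left b b' && (b' \in S')] ||
         [exists b', immediately_above b b' && (b' \in S)] then 0 else wt k b)
     + (b \in S')%:R
   else (b \notin S')%:R).

(** Expanding the product, each box takes its weight if it lies in [D], and otherwise the indicator
    that [S] and [S'] agree there; a non-addable [D] meets a zero factor. *)
Lemma step_setE k S S' :
  step_set k S S' = \sum_(D | addable S S' D) \prod_(b in D) wt k b.
Proof.
pose f b := if (b \in S) && ~~ ([exists b', immediately_left b b' && (b' \in S')] ||
         [exists b', immediately_above b b' && (b' \in S)]) then wt k b else 0.
pose g b : A := ((b \in S) == (b \in S'))%:R.
have -> : step_set k S S' = \prod_b (f b + g b).
  apply: eq_bigr => b _; rewrite /f /g; case: (b \in S) => /=; last by rewrite add0r eq_sym eqbF_neg.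
  by rewrite eq_sym eqb_id; case: (_ || _).
rewrite bigA_distr [RHS]big_mkcond; apply: eq_bigr => D _.
case: addableP => [[eqS hl ha]|nadd].
  rewrite [RHS]big_mkcond; apply: eq_bigr => b _; case: ifP => bD.
    rewrite /f -{1}eqS inE bD /= ifT // negb_or; apply/andP; split.
      by apply/existsPn => b'; apply/negP => /andP[/(hl _ _ bD)/negP].
    by apply/existsPn => b'; apply/negP => /andP[/(ha _ _ bD)/negP].
  by rewrite /g -eqS inE bD eqxx.
apply/eqP/negbNE/negP => /eqP nz; apply: nadd.
have {}nz b : (if b \in D then f b else g b) != 0.
  by apply/eqP => z; case: nz; rewrite (bigD1 b) //= z mul0r.
have fD b : b \in D -> (b \in S) && ~~ ([exists b', immediately_left b b' && (b' \in S')] ||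
         [exists b', immediately_above b b' && (b' \in S)]).
  by move=> bD; have := nz b; rewrite bD /f; case: ifP; rewrite ?eqxx.
split=> [|b b' bD l|b b' bD l].
- apply/setP => b; have := nz b; rewrite inE.
  case: ifP => [/fD/andP[-> _]//|bD]; rewrite /g.
  by case: ((b \in S) =P (b \in S')) => [->//|_]; rewrite eqxx.
- case/andP: (fD b bD) => _; rewrite negb_or => /andP[/existsPn/(_ b')].
  by rewrite l.
- case/andP: (fD b bD) => _; rewrite negb_or => /andP[_ /existsPn/(_ b')].
  by rewrite l.
Qed.

(** Remove [k] everywhere, then group by the support [S'] of what remains. *)
Lemma tab_sumS (k : 'I_n) S :
  tab_sum k.+1 S = \sum_S' step_set k S S' * tab_sum k S'.
Proof.
rewrite /tab_sum (reindex_onto (join k) (cut k)) /=; last by move=> T _; exact: cutK.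
rewrite (eq_bigl (fun p => tab k (supp p.1) p.1 && addable S (supp p.1) p.2)); last first.
  by case=> T D; rewrite tab_join.
rewrite -(pair_big_dep (fun T => tab k (supp T) T) (fun T D => addable S (supp T) D)
  (fun T D => tab_wt (join k (T, D)))) /=.
rewrite (partition_big supp xpredT) //=; apply: eq_bigr => S' _.
rewrite mulr_sumr; apply: eq_big => [T|T /andP[tabT /eqP suppT]].
  apply/andP/idP => [[tabT /eqP <-]//|tabT].
  have suppT : supp T = S' by apply/setP => b; rewrite inE; case/tabP: tabT.
  by rewrite suppT tabT.
rewrite step_setE mulr_suml suppT; apply: eq_bigr => D _; rewrite tab_wt_join //.
by move=> b; apply/negP; case/tabP: tabT => _ lt _ _ /lt; rewrite ltnn.
Qed.

Lemma tab_sum0 S : tab_sum 0 S = (S == set0)%:R.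
Proof.
have tab0 T : tab 0 S T = (T == [ffun=> set0]) && (S == set0).
  apply/tabP/andP => [[h1 h2 _ _]|[/eqP-> /eqP->]].
    have T0 b : T b = set0.
      by apply/eqP; apply: contraT => /set0Pn[r /h2].
    split; first by apply/eqP/ffunP => b; rewrite T0 ffunE.
    by apply/eqP/setP => b; rewrite -h1 T0 eqxx inE.
  by split=> [b|b r|b b' _ r r'|b b' _ r r']; rewrite ffunE ?inE ?eqxx.
rewrite /tab_sum (eq_bigl _ _ tab0); case: eqP => _; last first.
  by rewrite big_pred0 // => T; rewrite andbF.
under eq_bigl do rewrite andbT; rewrite big_pred1_eq /tab_wt big1 // => b _.
by rewrite ffunE big_set0.
Qed.

End Tableaux.

Lemma count_ltn_iota t c : (t <= c)%N -> count (fun j => j < t)%N (iota 0 c) = t.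
Proof.
move=> letc; rewrite -(subnKC letc) iotaD count_cat add0n.
have /eqP -> : count (fun j => j < t)%N (iota 0 t) == t.
  rewrite -[X in _ == X](size_iota 0) -all_count.
  by apply/allP => j; rewrite mem_iota.
have /eqP -> : count (fun j => j < t)%N (iota t (c - t)) == 0%N.
  rewrite -leqn0 leqNgt -has_count; apply/hasPn => j.
  by rewrite mem_iota -leqNgt => /andP[].
exact: addn0.
Qed.

(** * From sets of boxes to row lengths *)

Section Diagrams.
Variables (A : comNzRingType) (B u : nat -> A) (n : nat) (la : seq nat).
Implicit Types (b : box la) (S : {set box la}) (l m : nat -> nat).
Local Notation N := (size la).
Local Notation len i := (nth 0%N la i).

Definition diagram l : {set box la} := [set b : box la | (tagged b < l (tag b))%N].

Lemma box_inj b b' :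
  tag b = tag b' :> nat -> tagged b = tagged b' :> nat -> b = b'.
Proof.
case: b b' => [i j] [i' j'] /= /val_inj eqi; case: _ / eqi j' => j' /val_inj -> //.
Qed.

Lemma box_exists i j : (i < N)%N -> (j < len i)%N ->
  exists b, tag b = i :> nat /\ tagged b = j :> nat.
Proof.
by move=> ltiN ltj; exists (Tagged (fun i : 'I_N => 'I_(len i)) (Ordinal ltj : 'I_(len (Ordinal ltiN)))).
Qed.

Lemma ltn_tagged b : (tagged b < len (tag b))%N.
Proof. exact: ltn_ord. Qed.

Definition has_box S i j : bool :=
  [exists b : box la, [&& tag b == i :> nat, tagged b == j :> nat & b \in S]].

Lemma has_boxE S b : has_box S (tag b) (tagged b) = (b \in S).
Proof.
apply/existsP/idP => [[b' /and3P[/eqP e1 /eqP e2 b'S]]|bS]; last by exists b; rewrite !eqxx.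
by rewrite -(box_inj e1 e2).
Qed.

Lemma has_boxP S i j : reflect
  (exists2 b, b \in S & tag b = i :> nat /\ tagged b = j :> nat) (has_box S i j).
Proof.
apply: (iffP existsP) => [[b /and3P[/eqP ? /eqP ? ?]]|[b bS [e1 e2]]]; exists b => //.
by apply/and3P; split=> //; apply/eqP.
Qed.

Lemma has_box_left S b :
  [exists b', immediately_left b b' && (b' \in S)] = has_box S (tag b) (tagged b).+1.
Proof.
by apply: eq_existsb => b'; rewrite /immediately_left !eqSS [tag b == _ :> nat]eq_sym
  [_.+1 == _]eq_sym andbA.
Qed.

Lemma has_box_above S b :
  [exists b', immediately_above b b' && (b' \in S)] = has_box S (tag b).+1 (tagged b).
Proof.
by apply: eq_existsb => b'; rewrite /immediately_above !eqSS [_.+1 == _]eq_sym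
  [tagged b == _ :> nat]eq_sym andbA.
Qed.

Lemma has_box_diagram l i j : (forall i, (l i <= len i)%N) ->
  has_box (diagram l) i j = (j < l i)%N.
Proof.
move=> lel; apply/has_boxP/idP => [[b]|ltj].
  by rewrite inE => lt [<- <-].
have ltj' := leq_trans ltj (lel i).
have ltiN : (i < N)%N by rewrite ltnNge; apply: contraL ltj' => /(nth_default 0%N) ->.
by have [b [e1 e2]] := box_exists ltiN ltj'; exists b; rewrite // inE e2 e1.
Qed.

Lemma step_set_diagram k l m :
  (forall i, (l i <= len i)%N) -> (forall i, (m i <= len i)%N) ->
  (forall i, (l i.+1 <= l i)%N) ->
  step_set B u k (diagram l) (diagram m) = transfer_step B N (u k) k l m.
Proof.
move=> lel lem decr; rewrite /step_set /transfer_step big_ord_recr /=.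
have len0 i : (N <= i)%N -> len i = 0%N by move=> ?; rewrite nth_default.
have l0 i : (N <= i)%N -> l i = 0%N by move/len0 => e; apply/eqP; rewrite -leqn0 -e.
have m0 i : (N <= i)%N -> m i = 0%N by move/len0 => e; apply/eqP; rewrite -leqn0 -e.
rewrite [X in _ = _ * X](_ : _ = 1) ?mulr1; last first.
  by rewrite /row_new /row_old !l0 ?m0 ?leqnSn // ltnn big_geq ?mulr1.
rewrite /row_new /row_old.
pose w i j := u k * B (k.+1 + j - i)%N - 1.
pose F (i : 'I_N) (j : 'I_(len i)) := row_factor (w i) (l i) (l i.+1) (m i) j.
transitivity (\prod_(b : box la) F (tag b) (tagged b)).
  apply: eq_bigr => b _; rewrite has_box_left has_box_above !inE.
  by rewrite !has_box_diagram.
transitivity (\prod_(i < N) \prod_(j < len i) F i j); first by rewrite sig_big_dep.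
apply: eq_bigr => i _.
rewrite /F -(big_mkord xpredT (row_factor (w i) (l i) (l i.+1) (m i))).
rewrite row_factor_prod ?decr ?lel ?lem //; congr (_ * _).
case: ifP => // _; case: ltnP => // ltm; rewrite /w subrK.
by case: (m i) ltm => // t _; rewrite addSnnS.
Qed.

Definition diagram_parts M S : {ffun 'I_N.+1 -> 'I_M.+1} :=
  [ffun i : 'I_N.+1 => inord (count (has_box S i) (iota 0 (len i)))].

Lemma diagram_partsE M S i : (forall i, (len i <= M)%N) -> (i <= N)%N ->
  parts (diagram_parts M S) i = count (has_box S i) (iota 0 (len i)).
Proof.
move=> leM leiN; have /= -> := partsE (diagram_parts M S) (Ordinal (leiN : (i < N.+1)%N)).
rewrite ffunE /= inordK // ltnS; apply: leq_trans (leM i).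
by apply: leq_trans (count_size _ _) _; rewrite size_iota.
Qed.

(** A nonzero weight forces [S] to be left-justified: a box of [l] missing from [S] with its right
    neighbour in [S] gives 0, as does a box of [S] outside [l]. *)
Lemma diagram_partsK M k l S : (forall i, (len i <= M)%N) ->
  step_set B u k (diagram l) S != 0 -> diagram (parts (diagram_parts M S)) = S.
Proof.
move=> leM nz; apply/setP => b; rewrite inE diagram_partsE //; last exact/ltnW/ltn_ord.
rewrite count_down_closed ?has_boxE ?ltn_tagged // => j /has_boxP[b' b'S [e1 e2]].
have ltj : (j < len (tag b))%N by rewrite -e1 ltnW // -e2 ltn_tagged.
have [b2 [f1 f2]] := box_exists (ltn_ord (tag b)) ltj.
rewrite -f1 -f2 has_boxE; apply: contraR nz => b2S; rewrite /step_set.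
have [b'l|b'l] := boolP (b' \in diagram l); last first.
  by rewrite (bigD1 b') //= (negbTE b'l) b'S mul0r.
have b2l : b2 \in diagram l.
  by move: b'l; rewrite !inE f2 e2 f1 -e1 => /ltnW.
rewrite (bigD1 b2) //= b2l (negbTE b2S) has_box_left f2 -e2 f1 -e1 has_boxE b'S /=.
by rewrite addr0 mul0r.
Qed.

Lemma parts_diagram M (m : {ffun 'I_N.+1 -> 'I_M.+1}) :
  (forall i, (len i <= M)%N) -> (forall i, (parts m i <= len i)%N) ->
  diagram_parts M (diagram (parts m)) = m.
Proof.
move=> leM lem; apply/ffunP => i; apply/val_inj.
rewrite -[LHS]partsE -[RHS]partsE diagram_partsE //; last by rewrite -ltnS.
set P := has_box _ _; have PE j : P j = (j < parts m i)%N by rewrite /P has_box_diagram.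
by rewrite (eq_count PE) count_ltn_iota.
Qed.

(** Both sides satisfy the same recursion: sets that are not diagrams and lengths that do not
    interlace have weight 0, and the others correspond under [diagram]. *)
Lemma tab_sum_transfer M k l : (forall i, (len i <= M)%N) -> (k <= n)%N ->
  (forall i, (l i <= len i)%N) -> (forall i, (l i.+1 <= l i)%N) ->
  tab_sum B u n k (diagram l) = transfer B N M.+1 u k l.
Proof.
move=> leM; elim: k l => [|k IHk] l lekn lel decr.
  rewrite tab_sum0 /=; case: eqP => [diagram0|ne].
    rewrite big1 // => i _; case: (posnP (l i)) => [//|lt0].
    by move: (has_box_diagram i 0 lel); rewrite lt0 diagram0 => /has_boxP[b]; rewrite inE.
  have [i li] : exists i : 'I_N.+1, l i != 0%N.
    apply/existsP; apply: contraT; rewrite negb_exists => /forallP z.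
    case: ne; apply/setP => b; rewrite !inE.
    by have /negPn/eqP /= -> := z (widen_ord (leqnSn N) (tag b)).
  by rewrite (bigD1 i) //= (negbTE li) mul0r.
rewrite (tab_sumS _ _ (Ordinal lekn)) /=.
rewrite (bigID (fun S => step_set B u k (diagram l) S != 0)) /=.
rewrite [X in _ + X]big1 ?addr0 => [|S /negPn/eqP->]; last by rewrite mul0r.
rewrite (reindex_onto (fun m : {ffun 'I_N.+1 -> 'I_M.+1} => diagram (parts m)) (diagram_parts M)) /=; last first.
  by move=> S; apply: diagram_partsK.
have len0 i : (N <= i)%N -> len i = 0%N by move=> ?; rewrite nth_default.
have interlaced (m : {ffun 'I_N.+1 -> 'I_M.+1}) : transfer_step B N (u k) k l (parts m) != 0 ->
    forall i, (l i.+1 <= parts m i <= l i)%N.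
  move=> nz i; have [leiN|ltNi] := leqP i N; first exact: step_interlace nz _ leiN.
  by rewrite parts_oob // andbT -(len0 i.+1) ?lel // ltnW // ltnW.
rewrite [RHS](bigID (fun m : {ffun 'I_N.+1 -> 'I_M.+1} => transfer_step B N (u k) k l (parts m) != 0)) /=.
rewrite [X in _ = _ + X]big1 ?addr0 => [|m /negPn/eqP->]; last by rewrite mul0r.
apply: eq_big => [m|m].
  apply/andP/idP => [[nz /eqP mE]|nz].
    rewrite -step_set_diagram // => i; rewrite -mE; have [leiN|ltNi] := leqP i N.
      rewrite diagram_partsE //; apply: leq_trans (count_size _ _) _.
      by rewrite size_iota.
    by rewrite parts_oob.
  have lem i : (parts m i <= len i)%N.
    by case/andP: (interlaced m nz i) => _ le; apply: leq_trans le (lel i).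
  by rewrite step_set_diagram // parts_diagram.
case/andP=> nz /eqP mE.
have lem i : (parts m i <= len i)%N.
  rewrite -mE; have [leiN|ltNi] := leqP i N; last by rewrite parts_oob.
  by rewrite diagram_partsE //; apply: leq_trans (count_size _ _) _; rewrite size_iota.
rewrite step_set_diagram // in nz *; rewrite IHk ?(ltnW lekn) // => i.
case/andP: (interlaced m nz i.+1) => _ le1; case/andP: (interlaced m nz i) => le2 _.
exact: leq_trans le1 le2.
Qed.

End Diagrams.

(** * Symmetric polynomials and partial degrees *)

Section Symmetric.
Variables (R : comNzRingType) (n : nat).

Lemma msym_mpolyX (s : 'S_n) i : msym s 'X_i = 'X_(s i) :> {mpoly R[n]}.
Proof.
rewrite msymX; congr 'X_[_]; apply/mnmP => j; rewrite !mnmE.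
by rewrite -(inj_eq (@perm_inj _ s)) permKV.
Qed.

Lemma sym_adjacent (p : {mpoly R[n]}) :
  (forall i j : 'I_n, j = i.+1 :> nat -> msym (tperm i j) p = p) -> p \is symmetric.
Proof.
move=> adj; have lt_tperm d (i j : 'I_n) : j = (i + d.+1)%N :> nat -> msym (tperm i j) p = p.
  elim: d i j => [|d IHd] i j; first by rewrite addn1; apply: adj.
  move=> jE; have ltj : (i + d.+1 < n)%N by have := ltn_ord j; lia.
  pose k := Ordinal ltj.
  have -> : tperm i j = (tperm k j * tperm i k * tperm k j)%g.
    rewrite -{1}(tpermV k j) -mulgA -conjgE tpermJ tpermL tpermD //.
      by rewrite -val_eqE /=; lia.
    by rewrite -val_eqE /= jE; lia.
  have adj_kj : msym (tperm k j) p = p by apply: adj; rewrite jE addnS.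
  by rewrite !msymMm adj_kj (IHd i k).
have all_tperm (i j : 'I_n) : msym (tperm i j) p = p.
  have [lt|lt|/val_inj->] := ltngtP i j; last by rewrite tperm1 msym1m.
    by apply: (lt_tperm (j - i.+1)%N); lia.
  by rewrite tpermC; apply: (lt_tperm (i - j.+1)%N); lia.
apply/issymP => s; have [ts -> _] := prod_tpermP s.
elim: ts => [|t ts IHts]; first by rewrite big_nil msym1m.
by rewrite big_cons msymMm all_tperm.
Qed.

End Symmetric.

Section Degree.
Variables (R : idomainType) (n : nat) (r : 'I_n).
Implicit Types p q : {mpoly R[n]}.

Definition deg_le d p := forall m, m \in msupp p -> (m r <= d)%N.

Lemma deg_leW d d' p : (d <= d')%N -> deg_le d p -> deg_le d' p.
Proof. by move=> le dp m /dp le'; apply: leq_trans le' le. Qed.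

Lemma deg_le0 d : deg_le d 0.
Proof. by move=> m; rewrite msupp0. Qed.

Lemma deg_leC d c : deg_le d c%:MP.
Proof. by move=> m; rewrite msuppC; case: ifP => // _; rewrite inE => /eqP->; rewrite mnm0E. Qed.

Lemma deg_leD d p q : deg_le d p -> deg_le d q -> deg_le d (p + q).
Proof. by move=> dp dq m /msuppD_le; rewrite mem_cat => /orP[/dp|/dq]. Qed.

Lemma deg_leN d p : deg_le d p -> deg_le d (- p).
Proof. by move=> dp m; rewrite (perm_mem (msuppN p)); apply: dp. Qed.

Lemma deg_leZ d c p : deg_le d p -> deg_le d (c *: p).
Proof. by move=> dp m /msuppZ_le; apply: dp. Qed.

Lemma deg_leM d e p q : deg_le d p -> deg_le e q -> deg_le (d + e) (p * q).
Proof.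
move=> dp dq m /msuppM_le/allpairsP[[m1 m2] /= [/dp le1 /dq le2 ->]].
by rewrite mnmDE leq_add.
Qed.

Lemma deg_leX i : deg_le (i == r) 'X_i.
Proof. by move=> m; rewrite msuppX inE => /eqP->; rewrite mnm1E. Qed.

Lemma deg_le_sum d (I : Type) (s : seq I) (P : pred I) F :
  (forall i, P i -> deg_le d (F i)) -> deg_le d (\sum_(i <- s | P i) F i).
Proof.
by move=> dF; apply: (big_ind (deg_le d)) => //; [apply: deg_le0|apply: deg_leD].
Qed.

Lemma deg_le_prod (I : Type) (s : seq I) (P : pred I) (d : I -> nat) F :
  (forall i, P i -> deg_le (d i) (F i)) ->
  deg_le (\sum_(i <- s | P i) d i) (\prod_(i <- s | P i) F i).
Proof.
move=> dF; apply: (big_ind2 deg_le) => //; first by rewrite -mpolyC1; apply: deg_leC.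
by move=> d1 p1 d2 p2; apply: deg_leM.
Qed.

End Degree.

(** * The transfer over a polynomial ring *)

Section Polynomials.
Variables (K : fieldType) (n : nat) (be : K) (a : nat -> K).
Definition uvar r : {mpoly K[n]} :=
  oapp (fun i : 'I_n => 1 + be *: 'X_i) 0 (insub r).

Definition bconst k : {mpoly K[n]} := (1 + be * a k)%:MP.

Lemma uvarE (i : 'I_n) : uvar i = 1 + be *: 'X_i.
Proof. by rewrite /uvar valK. Qed.

(** A transposition of adjacent variables acts on [uvar] as [swap_at] and fixes [bconst]. *)
Lemma transfer_symmetric N M l : (forall i, (l i < M)%N) ->
  (forall i, (N <= i)%N -> l i = 0%N) ->
  transfer bconst N M uvar n l \is symmetric.
Proof.
move=> ltM l0; apply: sym_adjacent => i j jE.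
rewrite rmorph_transfer -[RHS](@transfer_swap _ bconst N M uvar n i l) -?jE //.
transitivity (transfer bconst N M (msym (tperm i j) \o uvar) n l).
  by apply: transfer_eqB => k; exact: mmapC.
apply: transfer_equ => r0 /= ltr; rewrite -[X in uvar X]/(nat_of_ord (Ordinal ltr)).
rewrite -[X in swap_at _ _ X]/(nat_of_ord (Ordinal ltr)); move: (Ordinal ltr) => {r0 ltr}r.
rewrite uvarE msymD msym1 msymZ msym_mpolyX /swap_at -jE !uvarE.
case: tpermP => [->|->|/eqP ne1 /eqP ne2].
- by rewrite eqxx.
- by rewrite eqxx jE gtn_eqF.
- by rewrite !val_eqE (negbTE ne1) (negbTE ne2).
Qed.

(** Row [i] has [l i - m i] new boxes, and a corner factor only if [l i.+1 < m i], hence degree at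
    most [l i - l i.+1]; the sum over the rows telescopes. *)
Lemma step_deg_le (r : 'I_n) k N l m : (k < n)%N ->
  deg_le r (if k == r then l 0%N else 0%N) (transfer_step bconst N (uvar k) k l m).
Proof.
move=> ltkn; have [->|nz] := eqVneq (transfer_step bconst N (uvar k) k l m) 0; first exact: deg_le0.
have inter := step_interlace nz.
have deg_u c : deg_le r (k == r) (uvar k * c%:MP).
  have /= -> := uvarE (Ordinal ltkn).
  rewrite -[nat_of_bool _]addn0; apply: deg_leM; last exact: deg_leC.
  apply: deg_leD; first by rewrite -mpolyC1; apply: deg_leC.
  by apply: deg_leZ; apply: (@deg_leX _ _ _ (Ordinal ltkn)).
have {}inter (i : 'I_N.+1) : (l i.+1 <= m i <= l i)%N by apply: inter; rewrite -ltnS.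
apply: (@deg_leW _ _ _ (\sum_(i < N.+1) (k == r) * (l i - l i.+1))).
  rewrite -big_distrr /=; case: (k == r); last by rewrite mul0n.
  rewrite mul1n; suff <- : (\sum_(i < N.+1) (l i - l i.+1) + l N.+1 = l 0)%N by exact: leq_addr.
  have decr (i : 'I_N.+1) : (l i.+1 <= l i)%N.
    by case/andP: (inter i) => le1 le2; apply: leq_trans le1 le2.
  elim: {deg_u nz inter} N decr => [|N IHN] decr.
    by rewrite big_ord_recr big_ord0 /= add0n subnK //; apply: (decr ord0).
  rewrite big_ord_recr /= -addnA subnK; last exact: (decr ord_max).
  by rewrite IHN // => i; apply: (decr (widen_ord (leqnSn _) i)).
apply: deg_le_prod => i _; have /andP[le1 le2] := inter i.
rewrite /row_new /row_old le1 le2.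
apply: (@deg_leW _ _ _ ((k == r) * (l i - m i) + (k == r) * (l i.+1 < m i))).
  by rewrite -mulnDr leq_mul2l; apply/orP; right; case: ltnP => /=; lia.
apply: deg_leM.
  have -> : ((k == r) * (l i - m i) = \sum_(m i <= j < l i) (k == r))%N.
    by rewrite sum_nat_const_nat mulnC.
  apply: deg_le_prod => j _; apply: deg_leD; first exact: deg_u.
  by apply: deg_leN; rewrite -mpolyC1; apply: deg_leC.
case: ltnP => _; first by rewrite muln1; apply: deg_u.
by rewrite -mpolyC1; apply: deg_leC.
Qed.

Lemma transfer_deg_le (r : 'I_n) k N M l : (k <= n)%N ->
  deg_le r (l 0%N) (transfer bconst N M uvar k l).
Proof.
(* The bound is 0 for [k <= r]: only the step with entry [r] involves [x_r]. *)
have: forall k l, (k <= n)%N ->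
  deg_le r (if (r < k)%N then l 0%N else 0%N) (transfer bconst N M uvar k l).
  elim=> [|k' IHk] l' lekn /=.
    have <- : (\sum_(i < N.+1) 0 = 0)%N by rewrite big1.
    by apply: deg_le_prod => i _; rewrite -[_%:R]mpolyC_nat; apply: deg_leC.
  apply: deg_le_sum => m _.
  have [->|nz] := eqVneq (transfer_step bconst N (uvar k') k' l' (parts m)) 0.
    by rewrite mul0r; apply: deg_le0.
  have /andP[_ le0] := step_interlace nz (leq0n N).
  apply: deg_leW (deg_leM (@step_deg_le r k' N l' (parts m) lekn) (IHk (parts m) (ltnW lekn))).
  by rewrite ltnS; case: (ltngtP r k') => /= _; lia.
by move=> /(_ k l) H /H; apply: deg_leW; case: ifP.
Qed.

Hypotheses (be_neq0 : be != 0) (a_inj : injective a).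
Hypothesis a_neq : forall k, 1 + be * a k != 0.

(** The solution [x_i] of [(1 + be * x_i) * (1 + be * a k) = 1] at the index [k] prescribed by
    [at_node]. *)
Definition node (rho : nat -> nat) (i : 'I_n) : K :=
  be^-1 * ((1 + be * a (rho (n - i.+1) + i.+1)%N)^-1 - 1).

Lemma meval_transfer N M l rho : exists B' u',
  [/\ (transfer bconst N M uvar n l).@[node rho] = transfer B' N M u' n l,
      injective B' & at_node B' rho n u'].
Proof.
exists (meval (node rho) \o bconst), (meval (node rho) \o uvar); split.
- exact: rmorph_transfer.
- move=> i j; rewrite /= !mevalC => /addrI /(mulfI be_neq0); exact: a_inj.
- move=> r ltrn; have /= -> := uvarE (Ordinal ltrn).
  rewrite mevalC mevalD meval1 mevalZ mevalXU /node mulrA mulfV // mul1r addrC subrK.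
  by rewrite mulVf.
Qed.

End Polynomials.

(** * Distinctness and non-vanishing of the parameters *)

Module CountablePolynomialFacts.
Import monalg.

Lemma mcoeff_cvar (F : fieldType) m k : mcoeff m (cvar F k) = (ucm k == m)%:R.
Proof. exact: mcoeffU. Qed.

Lemma cvar_inj (F : fieldType) : injective (cvar F).
Proof.
move=> i j eq_ij; have := mcoeff_cvar F (ucm i) j.
case: _ / eq_ij; rewrite mcoeff_cvar eqxx.
case: (ucm j =P ucm i) => [e _|_ /eqP]; last by rewrite oner_eq0.
by have := ucmE j i; rewrite e ucmE eqxx; case: eqP.
Qed.

(** Index 0, where [avar] is [beta], is included: it is one more variable. *)
Lemma avar_inj (F : fieldType) : injective (avar F).
Proof. by move=> i j /eqP; rewrite tofrac_eq => /eqP/cvar_inj. Qed.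

Lemma beta_neq0 (F : fieldType) : beta F != 0.
Proof.
rewrite tofrac_eq0; apply/eqP => /(congr1 (mcoeff (ucm 0))).
by rewrite mcoeff_cvar eqxx mcoeff0 => /eqP; rewrite oner_eq0.
Qed.

(** The constant coefficient is multiplicative and kills the variables, so it is 1 here. *)
Lemma one_avar_neq0 (F : fieldType) k : 1 + beta F * avar F k != 0.
Proof.
rewrite /beta /avar -tofracM -tofrac1 -tofracD tofrac_eq0.
apply/eqP => /(congr1 (mcoeff mone)).
rewrite mcoeffD mcoeff1 eqxx mcoeff0.
rewrite [mcoeff mone (_ * _)](rmorphM (mcoeff mone)) [X in _ + X * _](_ : _ = 0).
  by rewrite mul0r addr0 => /eqP; rewrite oner_eq0.
by apply: etrans (mcoeff_cvar _ _ _) _; rewrite cm1_eq1.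
Qed.

End CountablePolynomialFacts.
Export CountablePolynomialFacts.

(** * From maxima and minima to single entries *)

Lemma leq_bigmin k d (I : Type) (s : seq I) (P : pred I) (F : I -> nat) :
  (k <= \big[minn/d]_(i <- s | P i) F i)%N =
  (k <= d)%N && all (fun i => P i ==> (k <= F i)%N) s.
Proof.
elim: s => [|i s IHs]; first by rewrite big_nil andbT.
by rewrite big_cons /=; case: (P i); rewrite ?leq_min IHs // andbCA.
Qed.

Section Entries.
Variable n : nat.
Implicit Types S : {set 'I_n}.

Lemma leq_min_entry k S :
  (k <= min_entry S)%N = (k <= n)%N && [forall r in S, (k <= r.+1)%N].
Proof.
rewrite leq_bigmin; congr (_ && _); apply/allP/forall_inP => le r.
  by apply/implyP/le/mem_index_enum.
by move=> _; apply/implyP => /le.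
Qed.

Lemma max_le_min_entry S S' :
  (max_entry S <= min_entry S')%N = [forall r in S, forall r' in S', (r <= r')%N].
Proof.
apply/bigmax_leqP/forall_inP => le r /le; rewrite leq_min_entry ltn_ord //=.
Qed.

(** For empty [S'] the default minimum [n] does not exceed an entry [n] of [S], so the strict
    version needs [S'] non-empty. *)
Lemma max_lt_min_entry S S' : S' != set0 ->
  (max_entry S < min_entry S')%N = [forall r in S, forall r' in S', (r < r')%N].
Proof.
case/set0Pn => r0 r0S'; rewrite leq_min_entry.
apply/andP/forall_inP => [[_ /forall_inP le] r rS|le].
  apply/forall_inP => r' /le; rewrite ltnS; apply: leq_trans.
  by rewrite /max_entry (bigmax_sup r).
have le_max (r' : 'I_n) : r' \in S' -> (max_entry S <= r')%N.
  by move=> r'S'; apply/bigmax_leqP => r /le/forall_inP; apply.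
split; first by apply: leq_ltn_trans (le_max _ r0S') (ltn_ord r0).
by apply/forall_inP => r' /le_max.
Qed.

Lemma set_valued_tableauE la (T : {ffun box la -> {set 'I_n}}) :
  set_valued_tableau T = tab n setT T.
Proof.
rewrite /set_valued_tableau /tab.
have -> : [forall b, forall r in T b, (r < n)%N].
  by apply/forallP => b; apply/forall_inP => r _; apply: ltn_ord.
have -> : [forall b, (T b != set0) == (b \in setT)] = [forall b, T b != set0].
  by apply: eq_forallb => b; rewrite in_setT eqb_id.
case: forallP => //= ne; congr (_ && _).
  by do 2!apply: eq_forallb => ?; rewrite max_le_min_entry.
by do 2!apply: eq_forallb => ?; rewrite max_lt_min_entry //; apply: ne.
Qed.

Lemma card_box la : #|box la| = sumn la.
Proof.
rewrite card_tagged; congr (sumn _).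
under eq_map do rewrite card_ord.
rewrite (map_comp (nth 0%N la) val) val_enum_ord.
exact: mkseq_nth.
Qed.

End Entries.

Lemma oplus_scale (R : comNzRingType) n (c a : R) (x : {mpoly R[n]}) :
  (1 + c *: x) * (1 + c * a)%:MP - 1 = c *: (x + a%:MP + c *: (x * a%:MP)).
Proof.
rewrite -!mul_mpolyC mpolyCD mpolyCM mpolyC1.
by move: (c%:MP) (a%:MP) => c' a'; ring.
Qed.

Lemma partition_nth_le (la : seq nat) i j : is_partition la -> (i <= j)%N ->
  (nth 0 la j <= nth 0 la i)%N.
Proof.
case/andP=> sorted_la _; elim: j => [|j IHj]; first by rewrite leqn0 => /eqP->.
rewrite leq_eqVlt => /predU1P[->//|/IHj]; apply: leq_trans.
have [lt|ge] := ltnP j.+1 (size la); last by rewrite nth_default.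
by have /(sortedP 0%N)/(_ j lt) := sorted_la.
Qed.

(** * The polynomials [Groth] as transfers *)

Section GrothTransfer.
Variables (F : fieldType) (n : nat) (la : seq nat).
Local Notation K := (ratfun F).
Local Notation bconst := (@bconst K n (beta F) (avar F)).
Local Notation uvar := (@uvar K n (beta F)).

Lemma wt_oplus (r : 'I_n) (b : box la) : wt bconst uvar r b =
  beta F *: oplus 'X_r (avar F (entry r + box_col b - box_row b))%:MP.
Proof.
rewrite /wt uvarE /bconst /oplus /entry /box_col /box_row addnS subSS.
exact: oplus_scale.
Qed.

Lemma tableau_size_ge (T : {ffun box la -> {set 'I_n}}) :
  set_valued_tableau T -> (sumn la <= tableau_size T)%N.
Proof.
rewrite set_valued_tableauE => /tabP[ne _ _ _].
rewrite -card_box -sum1_card; apply: leq_sum => b _.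
by rewrite card_gt0 ne inE.
Qed.

(** Every entry of a tableau absorbs one factor [beta]: the two exponents add up to the number of
    entries. *)
Lemma Groth_tab_sum :
  beta F ^+ sumn la *: Groth F n la = tab_sum bconst uvar n n [set: box la].
Proof.
rewrite /Groth scaler_sumr /tab_sum.
apply: eq_big => [T|T tabT]; first exact: set_valued_tableauE.
rewrite scalerA -exprD subnKC ?tableau_size_ge // /tab_wt /tableau_size.
rewrite expr_sum -scaler_prod; apply: eq_bigr => b _.
rewrite -prodr_const -scaler_prod; apply: eq_bigr => r _.
by rewrite wt_oplus.
Qed.

Lemma Groth_transfer : is_partition la ->
  beta F ^+ sumn la *: Groth F n la =
  transfer bconst (size la) (nth 0%N la 0).+1 uvar n (nth 0%N la).
Proof.
move=> part_la; rewrite Groth_tab_sum.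
have -> : [set: box la] = diagram la (nth 0%N la) by apply/setP => b; rewrite !inE ltn_tagged.
by apply: tab_sum_transfer => // i; apply: partition_nth_le.
Qed.

End GrothTransfer.

(** * Bases *)

(** Drives the induction for independence. With no zero parts, [s != t] forces a strict inequality
    in some row. *)
Lemma sumn_partition_lt (s t : seq nat) : 0%N \notin s -> 0%N \notin t ->
  (forall i, (nth 0 s i <= nth 0 t i)%N) -> s != t -> (sumn s < sumn t)%N.
Proof.
elim: s t => [|x s IHs] [|y t] //=; rewrite !inE ?negb_or.
- by move=> _ /andP[y0 _] _ _; rewrite ltn_addr // lt0n eq_sym.
- by move=> /andP[x0 _] _ /(_ 0%N) /=; rewrite leqn0 eq_sym (negbTE x0).
move=> /andP[_ s0] /andP[_ t0] le; have le' i : (nth 0 s i <= nth 0 t i)%N by apply: (le i.+1).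
have := le 0%N; rewrite /= leq_eqVlt eqseq_cons => /predU1P[->|ltxy].
  by rewrite eqxx ltn_add2l; apply: IHs.
move=> _; apply: leq_trans (_ : y + sumn s <= _)%N; first by rewrite ltn_add2r.
rewrite leq_add2l; have [->//|ne] := eqVneq s t.
exact/ltnW/IHs.
Qed.

Lemma nth_filter_neq0 (s : seq nat) i : sorted geq s ->
  nth 0%N [seq x <- s | x != 0%N] i = nth 0%N s i.
Proof.
elim: s i => //= x s IHs i path_s; have sorted_s := path_sorted path_s.
case: eqP => [x0|_] /=; last by case: i => //= i; apply: IHs.
have s0 y : y \in s -> y = 0%N.
  have geq_trans : transitive geq by move=> a b c /= le1 le2; apply: leq_trans le2 le1.
  by move=> /(allP (order_path_min geq_trans path_s)) /=; rewrite x0 leqn0 => /eqP.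
have -> : [seq y <- s | y != 0%N] = [::].
  by apply/eqP; rewrite -[_ == _]negbK -has_filter; apply/hasPn => y /s0 ->.
rewrite nth_nil.
case: i => [|i] /=; first by rewrite x0.
by have [lt|ge] := ltnP i (size s); [rewrite (s0 (nth 0%N s i)) ?mem_nth | rewrite nth_default].
Qed.

Section Spans.
Variables (K : fieldType) (V : lmodType K) (I : eqType) (v : I -> V).

(** [in_span] gives one coefficient to each index, so repeated values of [h] have their coefficients
    added. *)
Lemma in_span_sum (J : eqType) (r : seq J) (P : pred J) (h : J -> I) (d : J -> K) :
  in_span v (\sum_(j <- r | P j) d j *: v (h j)).
Proof.
exists (undup (map h r)), (fun x => \sum_(j <- r | P j && (h j == x)) d j).
under [RHS]eq_bigr do rewrite scaler_suml.
rewrite (exchange_big_dep P) /=; last by move=> x j _ /andP[].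
rewrite big_seq_cond [RHS]big_seq_cond; apply: eq_bigr => j /andP[jr Pj].
rewrite big_mkcond (bigD1_seq (h j)) ?undup_uniq ?mem_undup ?map_f //= Pj eqxx.
by rewrite big1 ?addr0 // => x; rewrite eq_sym => /negbTE ->.
Qed.

Lemma lin_indep_fin (J : finType) (h : J -> I) (d : J -> K) :
  lin_indep v -> injective h -> \sum_j d j *: v (h j) = 0 -> forall j, d j = 0.
Proof.
move=> indep injh sum0 j.
pose c x := if [pick j | h j == x] is Some j then d j else 0.
have ch j' : c (h j') = d j'.
  by rewrite /c; case: pickP => [k /eqP/injh->//|/(_ j')]; rewrite eqxx.
rewrite -ch; apply: (indep (map h (enum J))).
- by rewrite map_inj_uniq ?enum_uniq.
- by rewrite big_map big_enum -[RHS]sum0; apply: eq_bigr => k _; rewrite ch.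
- by rewrite map_f ?mem_enum.
Qed.

End Spans.

Section Triangular.
Variables (K : fieldType) (n : nat) (G : partition_upto n -> {mpoly K[n]}).
Hypothesis G_node : forall mu, exists v, (G mu).@[v] != 0 /\
  forall la, (G la).@[v] != 0 -> forall i, (nth 0 (val la) i <= nth 0 (val mu) i)%N.

(** At the point of [mu] the surviving terms other than [mu] have indices strictly inside [mu], so
    their coefficients vanish by induction on the size. *)
Lemma triangular_lin_indep : lin_indep G.
Proof.
move=> s c uniq_s sum0.
have H N mu : (sumn (val mu) < N)%N -> mu \in s -> c mu = 0; last first.
  by move=> mu; apply: (H (sumn (val mu)).+1).
elim: N mu => // N IHN mu; rewrite ltnS => leN mus.
have [v [nz small]] := G_node mu.
have /(congr1 (meval v)) := sum0; rewrite meval0 raddf_sum /= (bigD1_seq mu) //=.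
rewrite big_seq_cond big1 ?addr0 => [|la /andP[las ne]].
  by rewrite mevalZ => /eqP; rewrite mulf_eq0 (negbTE nz) orbF => /eqP.
rewrite mevalZ; have [->|nzla] := eqVneq (G la).@[v] 0; first by rewrite mulr0.
rewrite IHN ?mul0r //; apply: leq_trans leN; apply: sumn_partition_lt => //.
- by case/andP: (valP la) => /andP[].
- by case/andP: (valP mu) => /andP[].
- exact: small.
Qed.

Hypothesis G_sym : forall la, G la \is symmetric.
Hypothesis G_deg : forall la r, deg_le r (nth 0%N (val la) 0) (G la).

Section BoundedDegree.
Variable d : nat.

(** These sequences index both the monomials [mon_of] and the partitions in the [n] by [d]
    rectangle. *)
Definition box_shape := {f : {ffun 'I_n -> 'I_d.+1} |
  [forall i : 'I_n, forall j : 'I_n, (i <= j)%N ==> (f j <= f i)%N]}.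

Definition mon_of (f : box_shape) : 'X_{1..n} := [multinom (val f i : nat) | i < n].

(** The leading monomial of a nonzero symmetric polynomial has weakly decreasing exponents, so it is
    some [mon_of f]. *)
Lemma sym_bounded_eq0 (p : {mpoly K[n]}) : p \is symmetric ->
  (forall r, deg_le r d p) -> (forall f, p@_(mon_of f) = 0) -> p = 0.
Proof.
move=> symp degp coef0; apply/eqP; apply: contraT => nzp.
have lep (i : 'I_n) : (mlead p i < d.+1)%N by rewrite ltnS; apply/degp/mlead_supp.
pose f : {ffun 'I_n -> 'I_d.+1} := [ffun i => Ordinal (lep i)].
have decr : [forall i : 'I_n, forall j : 'I_n, (i <= j)%N ==> (f j <= f i)%N].
  apply/forallP => i; apply/forallP => j; apply/implyP => leij.
  by rewrite !ffunE; apply: mlead_msym_sorted.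
have := coef0 (Sub f decr); rewrite (_ : mon_of _ = mlead p).
  by move/eqP; rewrite mleadc_eq0 (negbTE nzp).
by apply/mnmP => i; rewrite mnmE SubK ffunE.
Qed.

Definition rows (f : box_shape) : seq nat := [seq (val f i : nat) | i <- enum 'I_n].

Lemma nth_rows f (i : 'I_n) : nth 0%N (rows f) i = val f i.
Proof. by rewrite (nth_map i) ?size_enum_ord // nth_ord_enum. Qed.

Lemma rows_sorted f : sorted geq (rows f).
Proof.
apply/(sortedP 0%N) => i; rewrite size_map size_enum_ord => lt.
have := valP f => /forallP/(_ (Ordinal (ltnW lt)))/forallP/(_ (Ordinal lt)).
by rewrite leqnSn -!nth_rows.
Qed.

Lemma partition_of_subproof f : let la := [seq x <- rows f | x != 0%N] in
  is_partition la && (size la <= n)%N.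
Proof.
rewrite /= /is_partition mem_filter eqxx andbT size_filter.
apply/andP; split; last first.
  by apply: leq_trans (count_size _ _) _; rewrite size_map size_enum_ord.
apply: sorted_filter (rows_sorted f) => a b c /= le1 le2; exact: leq_trans le2 le1.
Qed.

Definition partition_of f : partition_upto n :=
  exist (fun la : seq nat => is_partition la && (size la <= n)%N) _ (partition_of_subproof f).

Lemma nth_partition_of f i : nth 0%N (val (partition_of f)) i = nth 0%N (rows f) i.
Proof. by rewrite nth_filter_neq0 // rows_sorted. Qed.

Lemma partition_of_inj : injective partition_of.
Proof.
move=> f g eq_fg; apply/val_inj/ffunP => i; apply/val_inj.
by rewrite /= -!nth_rows -!nth_partition_of eq_fg.
Qed.

Lemma G_partition_of_deg f r : deg_le r d (G (partition_of f)).
Proof.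
apply: (deg_leW _ (@G_deg (partition_of f) r)); rewrite nth_partition_of.
by rewrite (nth_rows f (Ordinal (leq_ltn_trans (leq0n r) (ltn_ord r)))) -ltnS.
Qed.

(* The matrix of coefficients is square, so its injectivity (independence)
   gives its surjectivity (generation). *)
Lemma sym_bounded_span (p : {mpoly K[n]}) : p \is symmetric ->
  (forall r, deg_le r d p) -> in_span G p.
Proof.
move=> symp degp; pose N := #|{: box_shape}|.
pose g (i : 'I_N) := G (partition_of (enum_val i)).
pose co (q : {mpoly K[n]}) : 'rV[K]_N := \row_j q@_(mon_of (enum_val j)).
pose C : 'M[K]_N := \matrix_(i, j) (g i)@_(mon_of (enum_val j)).
have coE (c : 'rV[K]_N) : c *m C = co (\sum_i c 0 i *: g i).
  apply/rowP => j; rewrite !mxE raddf_sum; apply: eq_bigr => i _.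
  by rewrite !mxE /= mcoeffZ.
have co_eq0 q : q \is symmetric -> (forall r, deg_le r d q) -> co q = 0 -> q = 0.
  move=> symq degq coq0; apply: sym_bounded_eq0 => // f.
  by have /rowP/(_ (enum_rank f)) := coq0; rewrite !mxE enum_rankK.
have sym_lin (c : 'rV[K]_N) : \sum_i c 0 i *: g i \is symmetric.
  by apply: rpred_sum => i _; apply: rpredZ; apply: G_sym.
have deg_lin (c : 'rV[K]_N) r : deg_le r d (\sum_i c 0 i *: g i).
  by apply: deg_le_sum => i _; apply: deg_leZ; apply: G_partition_of_deg.
have C_unit : C \in unitmx.
  rewrite -row_free_unit; apply: inj_row_free => c; rewrite coE => /co_eq0 sum0.
  apply/rowP => i; rewrite mxE.
  apply: (lin_indep_fin (h := fun i => partition_of (enum_val i)) triangular_lin_indep) => //.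
    by move=> i1 i2 /partition_of_inj/enum_val_inj.
  exact: sum0.
pose c := co p *m invmx C.
have -> : p = \sum_i c 0 i *: g i; last exact: in_span_sum.
apply/eqP; rewrite -subr_eq0; apply/eqP/co_eq0; first by rewrite rpredB.
  by move=> r; apply: deg_leD => //; apply: deg_leN.
have -> : co (p - \sum_i c 0 i *: g i) = co p - c *m C.
  by rewrite coE; apply/rowP => j; rewrite !mxE mcoeffB.
by rewrite mulmxKV // subrr.
Qed.

End BoundedDegree.

Lemma sym_span (p : {mpoly K[n]}) : p \is symmetric -> in_span G p.
Proof.
move=> symp; apply: (@sym_bounded_span (msize p)) => // r m mp.
apply: leq_trans (ltnW (msize_mdeg_lt mp)).
by rewrite mdegE (bigD1 r) //= leq_addr.
Qed.

End Triangular.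

(** * Symmetric polynomials over a field and [Lambda] *)

Section SymmetricLambda.
Variables (K : fieldType) (n : nat).

Lemma map_mpoly_sym (R S : nzRingType) (f : {rmorphism R -> S}) (p : {mpoly R[n]}) :
  p \is symmetric -> map_mpoly f p \is symmetric.
Proof.
move=> symp; apply/issymP => s; apply/mpolyP => m.
by rewrite mcoeff_sym !mcoeff_map_mpoly msym_coeff.
Qed.

Lemma map_mesym k : map_mpoly intr (mesym n int k) = mesym n K k.
Proof.
by apply/mpolyP => m; rewrite mcoeff_map_mpoly !mcoeff_mesym /= mulrz_nat.
Qed.

(** By the fundamental theorem a symmetric polynomial is a polynomial in the elementary ones, whose
    monomials are images of integral symmetric polynomials. *)
Lemma Lambda_symmetric (p : {mpoly K[n]}) : Lambda p <-> p \is symmetric.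
Proof.
split=> [[s [c ->]]|/sym_fundamental[t [<- _]]].
  by apply: rpred_sum => f _; apply: rpredZ; apply: map_mpoly_sym (valP f).
rewrite comp_mpolyE.
have sym_h (m : 'X_{1..n}) : \prod_(i < n) (mesym n int i.+1) ^+ m i \is symmetric.
  by apply: rpred_prod => i _; apply: rpredX; apply: mesym_sym.
pose h m : sym_int n := exist (fun f : {mpoly int[n]} => f \is symmetric) _ (sym_h m).
rewrite (eq_bigr (fun m => t@_m *: map_mpoly intr (val (h m)))) => [|m _].
  exact: in_span_sum.
congr (_ *: _); rewrite rmorph_prod; apply: eq_bigr => i _.
by rewrite rmorphXn tnth_mktuple /= map_mesym.
Qed.

End SymmetricLambda.

Lemma Groth_eq_transfer (F : fieldType) n (la : partition_upto n) :
  Groth F n (val la) = beta F ^- sumn (val la) *: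
    transfer (bconst n (beta F) (avar F)) (size (val la)) (nth 0%N (val la) 0).+1
      (uvar n (beta F)) n (nth 0%N (val la)).
Proof.
rewrite -Groth_transfer; last by case/andP: (valP la).
by rewrite scalerA mulVf ?scale1r // expf_neq0 ?beta_neq0.
Qed.

Theorem theorem4p6 (F : fieldType) (n : nat) (n_gt0 : (0 < n)%N) :
  is_basis_of (fun la : partition_upto n => Groth F n (val la))
    (@Lambda (ratfun F) n).
Proof.
pose G (la : partition_upto n) := Groth F n (val la).
have part (la : partition_upto n) : is_partition (val la) by case/andP: (valP la).
have oob (la : partition_upto n) i : (n <= i)%N -> nth 0%N (val la) i = 0%N.
  move=> leni; rewrite nth_default // (leq_trans _ leni) //.
  by case/andP: (valP la).
have G_sym la : G la \is symmetric.
  rewrite /G Groth_eq_transfer; apply: rpredZ; apply: transfer_symmetric => i.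
    by rewrite ltnS partition_nth_le.
  exact: nth_default.
have G_deg la r : deg_le r (nth 0%N (val la) 0) (G la).
  by rewrite /G Groth_eq_transfer; apply: deg_leZ; apply: transfer_deg_le.
have G_node mu : exists v, (G mu).@[v] != 0 /\
    forall la, (G la).@[v] != 0 -> forall i, (nth 0 (val la) i <= nth 0 (val mu) i)%N.
  exists (node (beta F) (avar F) (nth 0%N (val mu))).
  have decr i j : (i <= j)%N -> (nth 0 (val mu) j <= nth 0 (val mu) i)%N.
    exact: partition_nth_le.
  have eval_neq0 la : exists B u : nat -> ratfun F, [/\ injective B, at_node B (nth 0%N (val mu)) n u &
      ((G la).@[node (beta F) (avar F) (nth 0%N (val mu))] != 0) =
      (transfer B (size (val la)) (nth 0%N (val la) 0).+1 u n (nth 0%N (val la)) != 0)].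
    have [B [u [evalE injB atB]]] := meval_transfer n (beta_neq0 F) (@avar_inj F)
      (one_avar_neq0 F) (size (val la)) (nth 0%N (val la) 0).+1 (nth 0%N (val la))
      (nth 0%N (val mu)).
    exists B, u; split; [exact: injB|exact: atB|].
    rewrite /G Groth_eq_transfer mevalZ evalE mulf_eq0.
    by rewrite invr_eq0 expf_eq0 (negbTE (beta_neq0 F)) andbF.
  split=> [|la].
    have [B [u [injB atB ->]]] := eval_neq0 mu.
    apply: (transfer_node decr (oob mu) atB _ _ injB) => [i|]; last exact: ltnSn.
    exact: nth_default.
  have [B [u [injB atB ->]]] := eval_neq0 la.
  move=> nz i; have [le|lt] := leqP i (size (val la)).
    exact: transfer_vanish decr (oob mu) atB nz _ le.
  by rewrite nth_default // ltnW.
split=> [la|p /Lambda_symmetric|].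
- exact/Lambda_symmetric/G_sym.
- exact: sym_span.
- exact: triangular_lin_indep.
Qed.
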